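(* Consider NOMA-assisted grant-free transmission (see context) with $K=2$ receive SNR levels, $N=1$ time slot per frame, $M$ users, transmit SNR $P$, slot duration $T>0$, target rate $R>0$, and transmission attempt probability $\mathbb{P}_{\rm TX}\in(0,1]$. For fixed $M$, let $\bar\Delta^N_M(\mathbb{P}_{\rm TX})$ denote the limit as $P\to\infty$ of the average AoI of user ${\rm U}_1$. Then, for $M\to\infty$, the choice of $\mathbb{P}_{\rm TX}$ that minimizes the average AoI is asymptotically $$\mathbb{P}_{\rm TX}^*=\frac{\eta}{M},$$ that is, if for each $M$ the value $\mathbb{P}_{{\rm TX},M}^*$ is a minimizer of $\bar\Delta^N_M$ over $(0,1]$, then $M\,\mathbb{P}_{{\rm TX},M}^*\to\eta$ as $M\to\infty$, where $\eta$ is the (unique) positive root of $$\left(1-\frac{\eta}{2}\right)e^{-\frac{\eta}{2}}+\left(1-\frac{\eta^2}{2}\right)e^{-\eta}=0 .$$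
   Context: Model. $M$ users ${\rm U}_1,\dots,{\rm U}_M$ communicate with one base station. Time is divided into frames of $N$ slots, each slot of duration $T$; here $N=1$, so each frame is one slot. At the beginning of each frame every user generates a new update (generate-at-request) and tries to deliver it in that frame; since $N=1$, all $M$ users contend in every slot. A successful update is received at the end of the slot in which it is transmitted. NOMA-assisted random access with $K=2$ levels. The base station preconfigures receive SNR levels $P_2=2^R-1$ and $P_1=(2^R-1)(1+(M-1)P_2)$ (noise power normalized to one), independent of the transmit power budget (transmit SNR) $P$. In each slot, each user independently chooses one of the two levels with probability $1/2$ each and independently makes a transmission attempt with probability $\mathbb{P}_{\rm TX}$; choices are independent across slots. Channel gains $h$ are i.i.d. (across users and slots) complex Gaussian with zero mean and unit variance. Level $P_k$ is infeasible for a user with channel gain $h$ if $P_k/|h|^2>P$, and the user's update then fails. (Whether such a user still interferes with others is immaterial, because only the limit $P\to\infty$ is considered, in which every level is feasible with probability tending to one.) The base station performs successive interference cancellation (SIC), processing level $P_1$ and then $P_2$. If exactly one user transmits at a level (with the level feasible), and SIC has not been terminated earlier, that user succeeds. If two or more users transmit at the same level, a collision occurs, all of them fail and SIC terminates, so a collision at $P_1$ makes all users at $P_2$ fail too. If no user transmits at $P_1$, SIC proceeds to $P_2$. Age of information (AoI). The instantaneous AoI of ${\rm U}_1$ at time $t$ is $\Delta(t)=t-T(t)$, where $T(t)$ is the generation time of ${\rm U}_1$'s freshest update successfully delivered to the base station by time $t$. The average AoI is $\bar\Delta=\lim_{T_\Delta\to\infty}\frac{1}{T_\Delta}\int_0^{T_\Delta}\Delta(t)\,dt$.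 Equivalently, $\bar\Delta=\frac{\mathcal{E}\{S_{j-1}Y_j\}}{\mathcal{E}\{Y_j\}}+\frac{\mathcal{E}\{Y_j^2\}}{2\mathcal{E}\{Y_j\}}$, where $S_j$ is the time between generation and reception of the $j$-th successful update of ${\rm U}_1$ and $Y_j$ is the time between the receptions of its $(j-1)$-th and $j$-th successful updates. *)

(* Defs.v *)
From HB Require Import structures.
From mathcomp Require Import all_boot all_order all_algebra finmap.
From mathcomp Require Import all_classical all_reals all_analysis.

Set Implicit Arguments.
Unset Strict Implicit.
Unset Printing Implicit Defensive.

Import Order.TTheory GRing.Theory Num.Theory.
Import numFieldNormedType.Exports.

Local Open Scope classical_set_scope.
Local Open Scope ring_scope.

(* Mutual independence of a family of classes of events; random variables X_i
   are independent when the classes [generated_events (X i)] are. *)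
Definition mutually_independent (R : realType) (d : measure_display)
    (Om : measurableType d) (Pr : probability Om R) (I : choiceType)
    (F : I -> set (set Om)) : Prop :=
  forall (J : {fset I}) (E : I -> set Om),
    (forall i, i \in J -> F i (E i)) ->
    Pr (\bigcap_(i in [set` J]) E i) = (\big[mule/1]_(i <- J) Pr (E i))%E.

Definition generated_events (d d' : measure_display) (Om : measurableType d)
    (S : measurableType d') (X : {mfun Om >-> S}) : set (set Om) :=
  preimage_set_system setT X measurable.

(* The randomness of M contending users over the slots n = 0, 1, 2, ...
   [gain i n] is the pair (real part, imaginary part) of the channel gain of
   user i in slot n; [high i n] is true if user i picks the level P_1 in slot n
   and false if it picks P_2; [attempt i n] is true if user i attempts to
   transmit in slot n.

   A complex Gaussian of mean zero and variance one is circularly symmetric: its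
   real and imaginary parts are independent centred normals of variance 1/2.
   The second parameter of [normal_prob] is the standard deviation. *)
Record noma_model (R : realType) (M : nat) (ptx : R) := NomaModel {
  disp : measure_display;
  Om : measurableType disp;
  Pr : probability Om R;
  gain : 'I_M -> nat -> {mfun Om >-> (R * R)%type};
  high : 'I_M -> nat -> {mfun Om >-> bool};
  attempt : 'I_M -> nat -> {mfun Om >-> bool};
  gain_law : forall i n (A : set (R * R)), measurable A ->
    distribution Pr (gain i n) A =
    (normal_prob 0 (Num.sqrt (2^-1 : R)) \x
     normal_prob 0 (Num.sqrt (2^-1 : R)))%E A;
  high_law : forall i n (B : set bool),
    distribution Pr (high i n) B = bernoulli_prob (2^-1 : R) B;
  attempt_law : forall i n (B : set bool),
    distribution Pr (attempt i n) B = bernoulli_prob ptx B;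
  draws_independent : mutually_independent Pr
    (fun j : 'I_M * nat * 'I_3 =>
       let: (i, n, k) := j in
       match val k with
       | 0%N => generated_events (gain i n)
       | 1%N => generated_events (high i n)
       | _ => generated_events (attempt i n)
       end)
}.

(* [rx_level M rate true] is P_1 and [rx_level M rate false] is P_2. *)
Definition rx_level (R : realType) (M : nat) (rate : R) (b : bool) : R :=
  let P2 := 2 `^ rate - 1 in
  if b then (2 `^ rate - 1) * (1 + (M%:R - 1) * P2) else P2.

Section slot.
Variables (R : realType) (M : nat) (ptx : R) (X : noma_model M ptx).
Variables (rate P : R).
Implicit Types (i : 'I_M) (n : nat) (b : bool) (w : Om X).

(* P_k / |h|^2 <= P, cleared of the denominator so that h = 0 is infeasible
   rather than subject to the convention x / 0 = 0. *)
Definition feasible n w b i : bool :=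
  rx_level M rate b <= P * ((gain X i n w).1 ^+ 2 + (gain X i n w).2 ^+ 2).

(* A user whose chosen level is infeasible stays silent. *)
Definition transmits n w b i : bool :=
  [&& attempt X i n w, high X i n w == b & feasible n w b i].

Definition num_tx n w b : nat := #|[pred i | transmits n w b i]|.

(* SIC processes P_1, then P_2 unless there was a collision at P_1. *)
Definition succeeds i n w : bool :=
  (transmits n w true i && (num_tx n w true == 1%N)) ||
  [&& (num_tx n w true <= 1)%N, transmits n w false i & num_tx n w false == 1%N].

End slot.

Section age.
Variables (R : realType) (M : nat) (ptx : R) (X : noma_model M ptx).
Variables (rate T P : R) (i : 'I_M).

(* Slot n is the interval [n T, (n + 1) T]: the update sent in it is generated
   at n T and, if successful, received at (n + 1) T.  Since [sup set0 = 0], the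
   age before the first reception is counted from time 0. *)
Definition freshest (w : Om X) (t : R) : R :=
  sup [set g | exists n : nat,
    [/\ succeeds rate P i n w, n.+1%:R * T <= t & g = n%:R * T]].

Definition AoI (w : Om X) (t : R) : R := t - freshest w t.

Definition time_average (w : Om X) (tau : R) : R :=
  tau^-1 * \int[lebesgue_measure]_(t in `[0, tau]) AoI w t.

(* The deterministic value to which the time averages converge almost surely. *)
Definition average_AoI : R :=
  get [set D : R | {ae Pr X, forall w, time_average w tau @[tau --> +oo] --> D}].

End age.

Definition limit_AoI (R : realType) (M : nat) (ptx : R) (X : noma_model M ptx)
    (rate T : R) (i : 'I_M) : R :=
  lim (average_AoI X rate T P i @[P --> +oo]).

(* Main.v *)
(* The successes of a user in successive slots are independent with a common
   probability q, so that the age is a renewal process and the average age is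
   almost surely T (1 / q + 1 / 2).  The strong law behind this is elementary: if
   A_n is the age in slots and S_n the sum of the A_k for k < n, then
   q S_n + A_n - n is a martingale with bounded second moments of its increments,
   so the second moment of q S_n - n is O(n); Chebyshev and Borel-Cantelli give
   S_n / n --> 1 / q along n = k^4, and monotonicity of S fills the gaps.

   As P grows infeasibility becomes negligible (the gain has bounded density), and
   minimizing the age amounts to maximizing the success probability with p / 2
   for each level.  Multiplied by 2 M, at p = x / M, it tends to
   g(x) = x exp(-x/2) + (x + x^2/2) exp(-x), and it is bounded by g up to a factor
   tending to 1, uniformly in x.  Since exp(x) g'(x) is strictly decreasing on
   x >= 0 and changes sign, g has a single maximizer eta, strictly increases before
   it and strictly decreases after it; hence M p must tend to eta. *)

Require Import Defs.
From mathcomp Require Import all_boot all_order all_algebra finmap.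
From mathcomp Require Import all_classical all_reals all_analysis.
From mathcomp Require Import measurable_realfun ring lra.

Import Order.TTheory GRing.Theory Num.Theory.
Import numFieldNormedType.Exports.

Local Open Scope classical_set_scope.
Local Open Scope ring_scope.

(** * The limiting throughput and its maximizer *)

Section throughput.
Context {R : realType}.
Implicit Types x y : R.

Definition throughput x : R := x * expR (- (x / 2)) + (x + x ^+ 2 / 2) * expR (- x).

Definition dthroughput x : R :=
  (1 - x / 2) * expR (- (x / 2)) + (1 - x ^+ 2 / 2) * expR (- x).

(** [dthroughput] itself is not monotone, since it is negative beyond its root and tends to 0;
    clearing the factor exp (- x) makes the sign change visible. *)
Definition scaled_dthroughput x : R := (1 - x / 2) * expR (x / 2) + (1 - x ^+ 2 / 2).

Lemma dthroughputE x : dthroughput x = expR (- x) * scaled_dthroughput x.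
Proof.
rewrite /dthroughput /scaled_dthroughput mulrDr mulrCA -expRD.
by rewrite (_ : - x + x / 2 = - (x / 2)) 1?[_ * expR (- x)]mulrC//; field.
Qed.

Lemma is_derive_expR_scale (c x : R) :
  is_derive x 1 (expR \o ( *:%R c)) (c * expR (c * x)).
Proof.
have h := @is_deriveZ R R R id c x 1 1 (is_derive_id x 1).
have := @is_derive1_comp R expR (c *: id) x _ _ (is_derive_expR _) h.
by rewrite /GRing.scale /= mulr1 mulrC; apply.
Qed.

Lemma is_derive_throughput x : is_derive x 1 throughput (dthroughput x).
Proof.
have d1 := is_deriveM (is_derive_id x 1) (is_derive_expR_scale (- 2^-1) x).
have d2 := is_deriveM (is_deriveD (is_derive_id x 1)
  (is_deriveZ 2^-1 (is_deriveX 2 (is_derive_id x 1)))) (is_derive_expR_scale (- 1) x).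
have d := is_deriveD d1 d2.
have -> : throughput = id * (expR \o ( *:%R (- 2^-1))) +
    (id + 2^-1 *: (id ^+ 2)) * (expR \o ( *:%R (- 1))) :> (R -> R).
  apply/funext => y; rewrite /throughput !fctE /= /GRing.scale /=.
  by congr (_ * expR _ + (_ + _) * expR _); ring.
apply: (@is_derive_eq _ _ _ _ _ _ _ _ d).
rewrite /dthroughput !fctE /= /GRing.scale /=.
have -> : - 2^-1 * x = - (x / 2) by ring.
have -> : - 1 * x = - x by ring.
by field.
Qed.

Lemma is_derive_scaled_dthroughput x :
  is_derive x 1 scaled_dthroughput (- (x / 4 * expR (x / 2)) - x).
Proof.
have d1 := is_deriveM (is_deriveB (is_derive_cst (1 : R) x 1)
  (is_deriveZ 2^-1 (is_derive_id x 1))) (is_derive_expR_scale 2^-1 x).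
have d2 := is_deriveB (is_derive_cst (1 : R) x 1)
  (is_deriveZ 2^-1 (is_deriveX 2 (is_derive_id x 1))).
have d := is_deriveD d1 d2.
have -> : scaled_dthroughput = (cst 1 - 2^-1 *: id) * (expR \o ( *:%R 2^-1)) +
    (cst 1 - 2^-1 *: (id ^+ 2)) :> (R -> R).
  by apply/funext => y; rewrite /scaled_dthroughput !fctE /= /GRing.scale /= ![_ / 2]mulrC.
apply: (@is_derive_eq _ _ _ _ _ _ _ _ d).
rewrite !fctE /= /GRing.scale /= [2^-1 * x]mulrC.
by field.
Qed.

Lemma continuous_is_derive (f df : R -> R) :
  (forall x, is_derive x 1 f (df x)) -> continuous f.
Proof. by move=> h x; apply/differentiable_continuous/derivable1_diffP; case: (h x). Qed.

Lemma scaled_dthroughput_decr x y : 0 <= x -> x < y ->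
  scaled_dthroughput y < scaled_dthroughput x.
Proof.
move=> x0 xy.
have [|c] := MVT xy (fun z _ => is_derive_scaled_dthroughput z).
  exact/continuous_subspaceT/(continuous_is_derive _ _ is_derive_scaled_dthroughput).
rewrite in_itv/= => /andP[xc cy] e.
rewrite -subr_lt0 e nmulr_rlt0 ?subr_gt0// subr_lt0.
have c0 : 0 < c by exact: le_lt_trans xc.
by rewrite (lt_trans _ c0)// oppr_lt0 mulr_gt0 ?expR_gt0 ?divr_gt0.
Qed.

Lemma exists_root_dthroughput : exists eta : R, [/\ 0 < eta, dthroughput eta = 0,
  (forall x, 0 <= x < eta -> 0 < dthroughput x) & (forall x, eta < x -> dthroughput x < 0)].
Proof.
(* The values at 0 and 2 are 2 and -1. *)
have := @IVT R scaled_dthroughput 0 2 0 (ler0n _ 2).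
have k0 : scaled_dthroughput 0 = 2.
  by rewrite /scaled_dthroughput mul0r expR0 expr0n /= mul0r subr0 mul1r.
have k2 : scaled_dthroughput 2 = -1.
  by rewrite /scaled_dthroughput divff ?pnatr_eq0// subrr mul0r; field.
case.
- exact/continuous_subspaceT/(continuous_is_derive _ _ is_derive_scaled_dthroughput).
- by rewrite k0 k2 ge_min le_max lerN10 ler0n orbT.
move=> eta; rewrite in_itv /= => /andP[eta0 _] ke; exists eta.
have eta_gt0 : 0 < eta.
  by rewrite lt_neqAle eta0 andbT; apply: contra_eqN ke => /eqP <-; rewrite k0 pnatr_eq0.
split=> // [|x /andP[x0 xe]|x xe]; rewrite dthroughputE.
- by rewrite ke mulr0.
- by rewrite mulr_gt0 ?expR_gt0// -ke scaled_dthroughput_decr.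
- by rewrite pmulr_rlt0 ?expR_gt0// -ke scaled_dthroughput_decr// ltW.
Qed.

Section maximizer.
Variable eta : R.
Hypothesis dpos : forall x, 0 <= x < eta -> 0 < dthroughput x.
Hypothesis dneg : forall x, eta < x -> dthroughput x < 0.

Let cthr : continuous throughput := continuous_is_derive _ _ is_derive_throughput.

Lemma throughput_incr x y : 0 <= x -> x < y -> y <= eta -> throughput x < throughput y.
Proof.
move=> x0 xy ye.
have [|c] := MVT xy (fun z _ => is_derive_throughput z).
  exact: continuous_subspaceT.
rewrite in_itv/= => /andP[xc cy] e.
rewrite -subr_gt0 e mulr_gt0 ?subr_gt0// dpos//.
by rewrite (le_trans x0 (ltW xc)) (lt_le_trans cy).
Qed.

Lemma throughput_decr x y : eta <= x -> x < y -> throughput y < throughput x.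
Proof.
move=> ex xy.
have [|c] := MVT xy (fun z _ => is_derive_throughput z).
  exact: continuous_subspaceT.
rewrite in_itv/= => /andP[xc cy] e.
by rewrite -subr_lt0 e nmulr_rlt0 ?subr_gt0// dneg// (le_lt_trans ex).
Qed.

(** Outside the window of radius e around [eta], monotonicity on either side keeps the throughput
    below its value at an endpoint, which is strictly less than the maximum that [v] approaches. The
    sequence [y] need not be bounded in advance. *)
Lemma cvg_throughput_maximizer (y : nat -> R) (v : nat -> R) :
  (forall n, 0 <= y n) -> (\forall n \near \oo, v n <= throughput (y n)) ->
  v n @[n --> \oo] --> throughput eta -> y n @[n --> \oo] --> eta.
Proof.
move=> y0 vy cv; apply/cvgrPdist_le => e e0.
have cl : \forall n \near \oo, throughput (eta + e) < v n.
  by apply: (cvgr_gt _ cv); apply: throughput_decr; rewrite ?ltrDl.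
(* The guard covers eta - e < 0, outside the range of monotonicity; there y n >= 0 already keeps y n
   above eta - e. *)
have cr : \forall n \near \oo, 0 <= eta - e -> throughput (eta - e) < v n.
  have [h|h] := leP 0 (eta - e); last exact: nearW.
  have H : \forall n \near \oo, throughput (eta - e) < v n.
    by apply: (cvgr_gt _ cv); apply: throughput_incr; rewrite ?gtrDl ?oppr_lt0.
  by apply: filterS H => n hn _.
near=> n.
have vyn : v n <= throughput (y n) by near: n.
have l : throughput (eta + e) < v n by near: n.
have r : 0 <= eta - e -> throughput (eta - e) < v n by near: n.
rewrite ler_norml; apply/andP; split; rewrite leNgt; apply/negP => h.
- have /lt_trans/(_ l) : throughput (y n) < throughput (eta + e).
    by apply: throughput_decr; lra.
  by rewrite ltNge vyn.
- have yn0 := y0 n; have /lt_trans/(_ (r _)) : throughput (y n) < throughput (eta - e).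
    by apply: throughput_incr; lra.
  by rewrite ltNge vyn => h'; have := h' ltac:(lra).
Unshelve. all: by end_near.
Qed.

End maximizer.
End throughput.

(** * Contention of finitely many users *)

Section contention.
Context {R : realType}.
Implicit Types (a b p : R) (m : nat).

(* The chance that a given user is decoded when each of the m + 1 users
   independently transmits at P_1 with probability a and at P_2 with probability
   b: alone at P_1, or alone at P_2 with no user or exactly one user at P_1. *)
Definition success_prob m a b : R :=
  a * (1 - a) ^+ m + b * (1 - a - b) ^+ m + m%:R * (a * b * (1 - a - b) ^+ m.-1).

Lemma success_prob_gt0 m a b : 0 < a < 1 -> 0 <= b -> 0 <= 1 - a - b ->
  0 < success_prob m a b.
Proof.
move=> /andP[a0 a1] b0 ab; rewrite /success_prob -addrA ltr_pwDl//.
  by rewrite mulr_gt0// exprn_gt0// subr_gt0.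
by rewrite addr_ge0 ?mulr_ge0 ?exprn_ge0// ltW.
Qed.

(** Invert 1 + t <= exp t at t = w / (1 - w), where 1 + t = 1 / (1 - w). *)
Lemma expR_ge_one_sub (w : R) : 0 <= w < 1 -> expR (- (w / (1 - w))) <= 1 - w.
Proof.
move=> /andP[w0 w1]; have w1' : 0 < 1 - w by rewrite subr_gt0.
rewrite expRN -[leRHS]invrK lef_pV2 ?posrE ?expR_gt0 ?invr_gt0//.
have e : (1 - w)^-1 = 1 + w / (1 - w) by field; rewrite gt_eqF.
rewrite [leLHS]e.
exact: expR_ge1Dx.
Qed.

Lemma one_sub_expn_le (w : R) m : w <= 1 -> (1 - w) ^+ m <= expR (- (m%:R * w)).
Proof.
move=> w1; rewrite -mulrN expRM_natl lerXn2r ?nnegrE ?expR_ge0 ?subr_ge0//.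
exact: expR_ge1Dx.
Qed.

(** Allowing n above the power m gives the powers M - 1 and M - 2 the common exponent M w, which is
    [eta] at w = eta / M. *)
Lemma one_sub_expn_ge (w : R) m n : 0 <= w < 1 -> (m <= n)%N ->
  expR (- (n%:R * w / (1 - w))) <= (1 - w) ^+ m.
Proof.
move=> w01 mn; have /andP[w0 w1] := w01.
apply: (@le_trans _ _ ((1 - w) ^+ n)).
  rewrite -mulrA -mulrN expRM_natl lerXn2r ?nnegrE ?expR_ge0 ?expR_ge_one_sub//.
  by rewrite subr_ge0 ltW.
by rewrite ler_wiXn2l// ?subr_ge0 ?gerBl// ltW.
Qed.

(* Comparing at k p rather than at (k + 2) p makes the bound uniform in p: it
   then follows from 1 - p <= exp (- p) alone, at the price of a factor that
   tends to 1. *)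
Lemma success_prob_ub k p : 0 <= p <= 1 ->
  2 * k.+2%:R * (k%:R / k.+2%:R) ^+ 2 * success_prob k.+1 (p / 2) (p / 2)
    <= throughput (k%:R * p).
Proof.
move=> /andP[p0 p1].
have pp : 1 - p / 2 - p / 2 = 1 - p by field.
rewrite /success_prob /throughput pp /=.
have M0 : 0 < k.+2%:R :> R by rewrite ltr0n.
have kM : k%:R / k.+2%:R <= 1 :> R by rewrite ler_pdivrMr// mul1r ler_nat 2?ltnW.
have kM0 : 0 <= k%:R / k.+2%:R :> R by rewrite divr_ge0.
have k1M : k.+1%:R / k.+2%:R <= 1 :> R by rewrite ler_pdivrMr// mul1r ler_nat.
have k1M0 : 0 <= k.+1%:R / k.+2%:R :> R by rewrite divr_ge0.
set s := k%:R / k.+2%:R in kM kM0 *; set s1 := k.+1%:R / k.+2%:R in k1M k1M0 *.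
have ks : k%:R = s * k.+2%:R :> R by rewrite /s divfK ?gt_eqF.
have ks1 : k.+1%:R = s1 * k.+2%:R :> R by rewrite /s1 divfK ?gt_eqF.
have e1 : (1 - p / 2) ^+ k.+1 <= expR (- (k%:R * p / 2)).
  rewrite -mulrA (le_trans _ (one_sub_expn_le _ _ _))//; last lra.
  by rewrite ler_wiXn2l//; lra.
have e2 : (1 - p) ^+ k <= expR (- (k%:R * p)) by exact: one_sub_expn_le.
have e3 : (1 - p) ^+ k.+1 <= expR (- (k%:R * p)).
  by rewrite (le_trans _ e2)// ler_wiXn2l//; lra.
set E1 := expR _ in e1 *; set E2 := expR _ in e2 e3 *.
have E10 : 0 <= E1 by exact: expR_ge0.
have E20 : 0 <= E2 by exact: expR_ge0.
have pM : 0 <= k.+2%:R * p by rewrite mulr_ge0.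
have ks2 : k%:R * p = s * (k.+2%:R * p) by rewrite ks mulrA.
have ss : s ^+ 2 * (k.+2%:R * p) <= k%:R * p.
  by rewrite ks2 ler_wpM2r// expr2 ler_piMl.
(* With M = k + 2 users, s = k / M turns M p into k p. The quadratic term consumes both factors s;
   in the linear terms the spare one is bounded by 1. *)
have -> : 2 * k.+2%:R * s ^+ 2 * (p / 2 * (1 - p / 2) ^+ k.+1 + p / 2 * (1 - p) ^+ k.+1 +
     k.+1%:R * (p / 2 * (p / 2) * (1 - p) ^+ k)) =
   s ^+ 2 * (k.+2%:R * p) * (1 - p / 2) ^+ k.+1 +
   (s ^+ 2 * (k.+2%:R * p) * (1 - p) ^+ k.+1 +
    s1 * (s * (k.+2%:R * p)) ^+ 2 / 2 * (1 - p) ^+ k).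
  by rewrite ks1; field.
rewrite [X in _ <= _ + X]mulrDl; apply: lerD; last apply: lerD; apply: ler_pM => //.
- by rewrite mulr_ge0 ?sqr_ge0.
- by rewrite exprn_ge0//; lra.
- by rewrite mulr_ge0 ?sqr_ge0.
- by rewrite exprn_ge0//; lra.
- by rewrite mulr_ge0// mulr_ge0 ?sqr_ge0.
- by rewrite exprn_ge0//; lra.
- by rewrite ler_wpM2r// ks2 ler_piMl// sqr_ge0.
Qed.

Variable eta : R.
Hypothesis eta0 : 0 < eta.

(* With u = 1 / (m + 1), the bound exp (- w / (1 - w)) <= 1 - w turns the scaled
   success probability at p = eta u into this. *)
Definition throughput_lb (u : R) : R :=
  eta * expR (- (eta / 2 / (1 - u * (eta / 2)))) +
  (eta + (1 - u) * (eta ^+ 2 / 2)) * expR (- (eta / (1 - u * eta))).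

Lemma success_prob_lb k : eta < k.+2%:R ->
  throughput_lb k.+2%:R^-1 <=
  2 * k.+2%:R * success_prob k.+1 (eta / k.+2%:R / 2) (eta / k.+2%:R / 2).
Proof.
move=> ek; have M0 : 0 < k.+2%:R :> R by rewrite ltr0n.
set w := eta / k.+2%:R.
have w0 : 0 <= w by rewrite divr_ge0// ltW.
have w1 : w < 1 by rewrite ltr_pdivrMr// mul1r.
have ew : eta = k.+2%:R * w by rewrite mulrC /w divfK// gt_eqF.
have pp : 1 - w / 2 - w / 2 = 1 - w by field.
rewrite /success_prob /throughput_lb pp /=.
have -> : k.+2%:R^-1 * (eta / 2) = w / 2 by rewrite /w; field; rewrite gt_eqF.
have -> : k.+2%:R^-1 * eta = w by rewrite mulrC.
have h1 := one_sub_expn_ge (w / 2) k.+1 k.+2 _ (leqnSn _).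
have h2 := one_sub_expn_ge w k.+1 k.+2 _ (leqnSn _).
have h3 := one_sub_expn_ge w k k.+2 _ (ltnW (leqnSn _)).
move: (h1 ltac:(lra)) (h2 ltac:(lra)) (h3 ltac:(lra)) => {}h1 {}h2 {}h3.
rewrite mulrA -ew in h1; rewrite -ew in h2; rewrite -ew in h3.
set E1 := expR _ in h1 *; set E2 := expR _ in h2 h3 *.
have -> : 2 * k.+2%:R * (w / 2 * (1 - w / 2) ^+ k.+1 + w / 2 * (1 - w) ^+ k.+1 +
   k.+1%:R * (w / 2 * (w / 2) * (1 - w) ^+ k)) =
   eta * (1 - w / 2) ^+ k.+1 + (eta * (1 - w) ^+ k.+1 +
   (1 - k.+2%:R^-1) * (eta ^+ 2 / 2) * (1 - w) ^+ k).
  rewrite ew; have -> : k.+1%:R = k.+2%:R - 1 :> R by rewrite [k.+2%:R]mulrSr addrK.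
  by field; rewrite gt_eqF.
rewrite [X in _ + X <= _]mulrDl; apply: lerD; last apply: lerD; rewrite ler_wpM2l ?(ltW eta0)//.
by rewrite mulr_ge0 ?divr_ge0 ?sqr_ge0// subr_ge0 invf_le1// ler1n.
Qed.

Lemma cvg_throughput_lb : throughput_lb n.+1%:R^-1 @[n --> \oo] --> throughput eta.
Proof.
have u0 : (n.+1%:R^-1 : R) @[n --> \oo] --> (0 : R) by exact: cvg_harmonic.
have q (c : R) : (- (c / (1 - n.+1%:R^-1 * c))) @[n --> \oo] --> - c.
  apply: cvgN; rewrite -[X in _ --> X]divr1; apply: cvgM; first exact: cvg_cst.
  apply: cvgV; first exact: oner_neq0.
  rewrite -[X in _ --> X]subr0; apply: cvgB; first exact: cvg_cst.
  by rewrite -(mul0r c); apply: cvgM => //; exact: cvg_cst.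
have E (c : R) : expR (- (c / (1 - n.+1%:R^-1 * c))) @[n --> \oo] --> expR (- c).
  by apply: continuous_cvg (q c); exact: continuous_expR.
apply: cvgD; apply: cvgM => //; first exact: cvg_cst.
apply: cvgD; first exact: cvg_cst.
rewrite -[X in _ --> X]mul1r; apply: cvgM; last exact: cvg_cst.
by rewrite -[X in _ --> X]subr0; apply: cvgB => //; exact: cvg_cst.
Qed.

Lemma cvg_success_prob_maximizer (p : nat -> R) :
  (forall x, 0 <= x < eta -> 0 < dthroughput x) ->
  (forall x, eta < x -> dthroughput x < 0) ->
  (forall m, 0 < p m <= 1) ->
  (forall m p', 0 < p' <= 1 ->
    success_prob m (p' / 2) (p' / 2) <= success_prob m (p m / 2) (p m / 2)) ->
  m.+1%:R * p m @[m --> \oo] --> eta.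
Proof.
move=> dpos dneg p01 pmax.
pose s n : R := n%:R / n.+2%:R.
have cs : s n @[n --> \oo] --> (1 : R).
  have -> : s = fun n => 1 - 2 * n.+2%:R^-1.
    apply/funext => n; rewrite /s; have : n.+2%:R != 0 :> R by rewrite pnatr_eq0.
    rewrite -[n.+2]addn2 natrD => h; by field.
  rewrite -[X in _ --> X]subr0; apply: cvgB; first exact: cvg_cst.
  rewrite -(mulr0 2); apply: cvgM; first exact: cvg_cst.
  by rewrite (cvg_shiftS (fun n => n.+1%:R^-1 : R)); exact: cvg_harmonic.
have cy : (n%:R * p n.+1) @[n --> \oo] --> eta.
  (* The lower sequence comes from comparing the optimum with the competitor eta / M, which is an
     admissible probability once M > eta. *)
  apply: (cvg_throughput_maximizer eta dpos dneg _ (fun n => s n ^+ 2 * throughput_lb n.+2%:R^-1)).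
  - by move=> n; rewrite mulr_ge0//; case/andP: (p01 n.+1) => /ltW.
  - near=> n.
    have en : eta < n.+2%:R.
      apply: (@lt_le_trans _ _ n%:R); last by rewrite ler_nat 2?ltnW.
      by near: n; exact: nbhs_infty_gtr.
    have M0 : 0 < n.+2%:R :> R by rewrite ltr0n.
    have /andP[pn0 pn1] := p01 n.+1.
    apply: le_trans (success_prob_ub n (p n.+1) _); last by rewrite ltW.
    rewrite [leRHS]mulrAC [leRHS]mulrC ler_wpM2l ?sqr_ge0//.
    apply: le_trans (success_prob_lb _ en) _.
    rewrite ler_wpM2l ?mulr_ge0// pmax// divr_gt0//=.
    by rewrite ler_pdivrMr// mul1r ltW.
  - rewrite -[X in _ --> X]mul1r; apply: cvgM.
      by rewrite -(expr1n _ 2); apply: cvgM.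
    by rewrite (cvg_shiftS (fun n => throughput_lb n.+1%:R^-1)); exact: cvg_throughput_lb.
(* Two shifts: the bounds start at two users, and [s 0 = 0] must be avoided when dividing by [s]. *)
rewrite -(cvg_shiftS (fun n => n.+1%:R * p n)) -(cvg_shiftS (fun n => n.+2%:R * p n.+1)).
have -> : (fun n => n.+3%:R * p n.+2) = fun n => (s n.+1)^-1 * (n.+1%:R * p n.+2).
  by apply/funext => n; rewrite /s invf_div mulrA divfK// pnatr_eq0.
suff : ((s n.+1)^-1 * (n.+1%:R * p n.+2)) @[n --> \oo] --> 1^-1 * eta.
  by rewrite invr1 mul1r.
apply: cvgM.
  apply: cvgV; first exact: oner_neq0.
  by rewrite (cvg_shiftS s).
by rewrite (cvg_shiftS (fun n => n%:R * p n.+1)).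
Unshelve. all: by end_near.
Qed.

End contention.

(** * A strong law for the age of independent bits *)

Fixpoint history (b : nat -> bool) n : seq bool :=
  if n is n'.+1 then b n' :: history b n' else [::].

(** * Moments of the age under independent bits *)

Section bit_histories.
Context {R : realType}.
Variable q : R.
Implicit Types (f g : seq bool -> R) (h : seq bool) (n : nat).

(* A history lists bits with the newest first. *)
Fixpoint mean n f : R :=
  if n is n'.+1 then mean n' (fun h => q * f (true :: h) + (1 - q) * f (false :: h))
  else f [::].

(** The base value 0 gives a history without success an age equal to its length, as if an update had
    been generated at time 0. *)
Fixpoint age h : nat := if h is b :: h' then if b then 1%N else (age h').+1 else 0%N.

(** The newest bit is skipped: the age at the start of a slot depends only on earlier slots, and the
    outcome of a slot shows at its end. *)
Fixpoint total_age h : nat := if h is _ :: h' then (age h' + total_age h')%N else 0%N.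

Lemma eq_mean n f g : f =1 g -> mean n f = mean n g.
Proof. by elim: n f g => //= n IH f g fg; apply: IH => h; rewrite !fg. Qed.

Lemma meanD n f g : mean n (fun h => f h + g h) = mean n f + mean n g.
Proof. by elim: n f g => //= n IH f g; rewrite -IH; apply: eq_mean => h; ring. Qed.

Lemma meanZ n c f : mean n (fun h => c * f h) = c * mean n f.
Proof. by elim: n f => //= n IH f; rewrite -IH; apply: eq_mean => h; ring. Qed.

Lemma mean_cst n c : mean n (fun=> c) = c.
Proof. by elim: n => //= n IH; rewrite -[RHS]IH; apply: eq_mean => h; ring. Qed.

Hypothesis q01 : 0 <= q <= 1.

Lemma le_mean n f g : (forall h, size h = n -> f h <= g h) -> mean n f <= mean n g.
Proof.
move: q01 => /andP[q0 q1]; elim: n f g => /= [|n IH] f g fg; first exact: fg.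
by apply: IH => h hn; rewrite lerD// ler_wpM2l ?subr_ge0// fg//= hn.
Qed.

Lemma mean_chebyshev n f (c d : R) : 0 < c -> mean n (fun h => f h ^+ 2) <= d ->
  mean n (fun h => (c < `|f h|)%R%:R) <= d / c ^+ 2.
Proof.
move=> c0 fd; rewrite ler_pdivlMr ?exprn_gt0// mulrC -meanZ.
apply: le_trans fd; apply: le_mean => h _.
case: ltP => [cf|_]; last by rewrite mulr0 sqr_ge0.
by rewrite mulr1 -[leRHS]real_normK ?num_real// lerXn2r ?nnegrE// ltW.
Qed.

Section age.
Hypothesis q_gt0 : 0 < q.

(** Averaging over the newest bit gives the recursion a' = 1 + (1 - q) a, whose fixed point is 1 /
    q; the start 0 lies below it. *)
Lemma mean_age_le n : mean n (fun h => (age h)%:R) <= q^-1.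
Proof.
move: q01 => /andP[q0 q1].
elim: n => /= [|n IH]; first by rewrite invr_ge0.
rewrite (@eq_mean _ _ (fun h => 1 + (1 - q) * (age h)%:R)); last by move=> h; ring.
rewrite meanD mean_cst meanZ.
apply: (@le_trans _ _ (1 + (1 - q) * q^-1)); first by rewrite lerD2l ler_wpM2l// subr_ge0.
by rewrite mulrBl divff ?gt_eqF// mul1r addrC subrK.
Qed.

Lemma mean_age2_le n : mean n (fun h => (age h)%:R ^+ 2) <= 2 / q ^+ 2.
Proof.
move: q01 => /andP[q0 q1].
elim: n => /= [|n IH]; first by rewrite expr0n /= divr_ge0 ?sqr_ge0.
rewrite (@eq_mean _ _ (fun h => 1 + (1 - q) * ((age h)%:R ^+ 2 + 2 * (age h)%:R))); last first.
  by move=> h; ring.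
rewrite meanD mean_cst meanZ meanD meanZ.
apply: (@le_trans _ _ (1 + (1 - q) * (2 / q ^+ 2 + 2 / q))).
  by rewrite lerD2l ler_wpM2l ?subr_ge0// lerD// ler_wpM2l// mean_age_le.
(* The recursion for the second moment preserves the bound 2 / q^2 with a slack of exactly 1. *)
rewrite -subr_ge0; have -> : 2 / q ^+ 2 - (1 + (1 - q) * (2 / q ^+ 2 + 2 / q)) = 1.
  by field; rewrite gt_eqF.
exact: ler01.
Qed.

(* Since the age becomes 1 with probability q and grows by 1 otherwise, this is a
   martingale in the length of the history. *)
Definition age_martingale h : R := q * (total_age h)%:R + (age h)%:R - (size h)%:R.

Lemma mean_age_martingale2_le n :
  mean n (fun h => age_martingale h ^+ 2) <= n%:R * (2 / q ^+ 2).
Proof.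
move: (q01) => /andP[q0 q1].
elim: n => /= [|n IH].
  by rewrite /age_martingale /= !mulr0n mulr0 addr0 subr0 expr0n mul0r.
(* The increment is - (1 - q) A on a success and q A on a failure, with A the current age; the cross
   terms cancel and the mean square is q (1 - q) A^2. *)
have -> : (fun h => q * age_martingale (true :: h) ^+ 2 +
                    (1 - q) * age_martingale (false :: h) ^+ 2) =
  (fun h => age_martingale h ^+ 2 + q * (1 - q) * (age h)%:R ^+ 2).
  by apply/funext => h; rewrite /age_martingale /= -!natr1 natrD; ring.
rewrite meanD meanZ -natr1 mulrDl mul1r lerD//.
apply: (@le_trans _ _ (1 * (2 / q ^+ 2))); last by rewrite mul1r.
apply: ler_pM; last exact: mean_age2_le.
- by rewrite mulr_ge0// subr_ge0.
- by rewrite -(mean_cst n 0); apply: le_mean => h _; exact: sqr_ge0.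
- by rewrite mulr_ile1 ?subr_ge0// gerBl.
Qed.

(** The deviation is [age_martingale] minus [age], and (x - y)^2 <= 2 (x^2 + y^2). *)
Lemma mean_total_age_dev2_le n :
  mean n (fun h => (q * (total_age h)%:R - n%:R) ^+ 2) <= n.+1%:R * (4 / q ^+ 2).
Proof.
apply: (@le_trans _ _
    (mean n (fun h => 2 * (age_martingale h ^+ 2 + (age h)%:R ^+ 2)))).
  apply: le_mean => h <-; rewrite /age_martingale -subr_ge0.
  rewrite (_ : _ - _ = (q * (total_age h)%:R + 2 * (age h)%:R - (size h)%:R) ^+ 2); last by ring.
  exact: sqr_ge0.
rewrite meanZ meanD -natr1 mulrDl mul1r.
have := mean_age_martingale2_le n; have := mean_age2_le n.
set x := 2 / q ^+ 2; have -> : 4 / q ^+ 2 = 2 * x by rewrite /x; ring.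
by lra.
Qed.

End age.
End bit_histories.

(** * From fourth powers to all indices *)

Section interpolation.
Context {R : realType}.

Lemma cvg_ratio_expn4 : (k.+1 ^ 4)%N%:R / (k ^ 4)%N%:R @[k --> \oo] --> (1 : R).
Proof.
rewrite -(cvg_shiftS (fun k => (k.+1 ^ 4)%N%:R / (k ^ 4)%N%:R : R)).
have -> : (fun n => (n.+2 ^ 4)%N%:R / (n.+1 ^ 4)%N%:R : R) = fun n => (1 + n.+1%:R^-1) ^+ 4.
  apply/funext => n; have n0 : n.+1%:R != 0 :> R by rewrite pnatr_eq0.
  rewrite !natrX -expr_div_n -natr1 mulrDl divff// div1r.
  by congr ((_ + _) ^+ 4).
suff : ((1 + n.+1%:R^-1) ^+ 4 : R) @[n --> \oo] --> (1 + 0 : R) ^+ 4.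
  by rewrite addr0 expr1n.
apply: (@continuous_cvg _ _ _ _ _ _ (fun x : R => x ^+ 4)).
  exact: exprn_continuous.
by apply: cvgD; [exact: cvg_cst|exact: cvg_harmonic].
Qed.

(** For k^4 <= n < (k + 1)^4, monotonicity puts S n / n between S (k^4) / (k + 1)^4 and S ((k +
    1)^4) / k^4; both tend to l because (k + 1)^4 / k^4 tends to 1. *)
Lemma cvg_mean_along_expn4 (S : nat -> nat) (l : R) :
  {homo S : m n / (m <= n)%N} ->
  (S (k ^ 4)%N)%:R / (k ^ 4)%N%:R @[k --> \oo] --> l ->
  (S n)%:R / n%:R @[n --> \oo] --> l.
Proof.
move=> S_nd cS.
have cr := cvg_ratio_expn4.
have cu : (S (k.+1 ^ 4)%N)%:R / (k ^ 4)%N%:R @[k --> \oo] --> l.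
  suff : (S (k.+1 ^ 4)%N)%:R / (k.+1 ^ 4)%N%:R * ((k.+1 ^ 4)%N%:R / (k ^ 4)%N%:R)
      @[k --> \oo] --> l * 1.
    rewrite mulr1; apply: cvg_trans; apply: near_eq_cvg; near=> k.
    by rewrite mulrA divfK// pnatr_eq0 expn_eq0.
  apply: cvgM => //.
  by rewrite (cvg_shiftS (fun k => (S (k ^ 4)%N)%:R / (k ^ 4)%N%:R : R)).
have cl : (S (k ^ 4)%N)%:R / (k.+1 ^ 4)%N%:R @[k --> \oo] --> l.
  suff : (S (k ^ 4)%N)%:R / (k ^ 4)%N%:R * ((k.+1 ^ 4)%N%:R / (k ^ 4)%N%:R)^-1
      @[k --> \oo] --> l * 1^-1.
    rewrite invr1 mulr1; apply: cvg_trans; apply: near_eq_cvg; near=> k.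
    rewrite invf_div mulrA divfK// pnatr_eq0 expn_eq0 andbT -lt0n.
    by near: k; exact: nbhs_infty_gt.
  apply: cvgM => //; apply: cvgV => //; exact: oner_neq0.
apply/cvgrPdist_le => e e0.
move/cvgrPdist_le : cu => /(_ e e0)[K1 _ HK1].
move/cvgrPdist_le : cl => /(_ e e0)[K2 _ HK2].
(* The 1 in the maximum keeps k, and hence the divisor k^4, positive. *)
exists (maxn 1 (maxn K1 K2) ^ 4)%N => // n /= Kn.
have n0 : (0 < n)%N by rewrite (leq_trans _ Kn)// expn_gt0 leq_max.
have [k kn nk] : exists2 k, (k ^ 4 <= n)%N & (n < k.+1 ^ 4)%N.
  have ex0 : exists k, (k ^ 4 <= n)%N by exists 0%N.
  have ub k : (k ^ 4 <= n)%N -> (k <= n)%N.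
    by apply: leq_trans; case: k => // k; rewrite expnS leq_pmulr ?expn_gt0.
  case: (ex_maxnP ex0 ub) => k kn kmax; exists k => //.
  by rewrite ltnNge; apply/negP => /kmax; rewrite ltnn.
have Kk : (maxn 1 (maxn K1 K2) <= k)%N.
  by rewrite -ltnS -(@ltn_exp2r _ _ 4)// (leq_ltn_trans Kn).
move: Kk; rewrite !geq_max => /and3P[k0 kK1 kK2].
have /= := HK1 k kK1; have /= := HK2 k kK2.
have k40 : 0 < (k ^ 4)%N%:R :> R by rewrite ltr0n expn_gt0 k0.
have n0' : 0 < n%:R :> R by rewrite ltr0n.
have : (S n)%:R / n%:R <= (S (k.+1 ^ 4)%N)%:R / (k ^ 4)%N%:R :> R.
  by rewrite ler_pM ?invr_ge0// ?ler_nat ?S_nd ?(ltnW nk)// lef_pV2 ?posrE// ler_nat.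
have : (S (k ^ 4)%N)%:R / (k.+1 ^ 4)%N%:R <= (S n)%:R / n%:R :> R.
  rewrite ler_pM ?invr_ge0// ?ler_nat ?S_nd// lef_pV2 ?posrE ?ltr0n ?expn_gt0//.
  by rewrite ler_nat ltnW.
rewrite !ler_norml => hl hu /andP[_ h2] /andP[h1 _].
by apply/andP; split; [apply: le_trans h1 _|apply: le_trans _ h2]; rewrite lerD2l lerN2.
Unshelve. all: by end_near.
Qed.

End interpolation.

(** * Almost sure convergence by Chebyshev and Borel-Cantelli *)

Section almost_sure_mean_age.
Context {d : measure_display} {Om : measurableType d} {R : realType}.
Variables (Pr : probability Om R) (B : nat -> Om -> bool) (q : R).

(** Independence and the common law are expressed together through the joint law of the first n
    bits, the form in which [mean_chebyshev] yields probabilities. *)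
Definition iid_bits := forall n (A : pred (seq bool)),
  measurable [set w | A (history (B^~ w) n)] /\
  Pr [set w | A (history (B^~ w) n)] = (mean q n (fun h => (A h)%:R))%:E.

(** Induction on the sharper telescoping bound 2 - 1 / (m + 1). *)
Lemma sum_inv_sqr_le n : \sum_(k < n) (k.+1%:R ^+ 2)^-1 <= 2 :> R.
Proof.
suff h m : \sum_(k < m.+1) (k.+1%:R ^+ 2)^-1 <= 2 - m.+1%:R^-1 :> R.
  by case: n => [|n]; [rewrite big_ord0|rewrite (le_trans (h n))// gerBl invr_ge0].
elim: m => [|m IH]; first by rewrite big_ord1 expr1n invr1; lra.
rewrite big_ord_recr /=; apply: le_trans (lerD IH (lexx _)) _.
rewrite -subr_ge0; set x : R := m.+1%:R.
have x0 : 0 < x by rewrite ltr0n.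
have -> : m.+2%:R = x + 1 :> R by rewrite natr1.
have -> : 2 - (x + 1)^-1 - (2 - x^-1 + ((x + 1) ^+ 2)^-1) = (x * (x + 1) ^+ 2)^-1.
  by field; apply/andP; split; apply/eqP => x'; lra.
by rewrite invr_ge0 mulr_ge0 ?sqr_ge0// ltW.
Qed.

Lemma total_age_history_homo w : {homo (fun n => total_age (history (B^~ w) n)) : m n / (m <= n)%N}.
Proof.
apply: homo_leq => //; first exact: leq_trans.
by move=> n /=; exact: leq_addl.
Qed.

Lemma ae_cvg_mean_age : 0 < q <= 1 -> iid_bits ->
  {ae Pr, forall w, (total_age (history (B^~ w) n))%:R / n%:R @[n --> \oo] --> q^-1}.
Proof.
move=> /andP[q0 q1] iid.
have q01 : 0 <= q <= 1 by rewrite ltW.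
(* At time (k + 1)^4 the deviation has second moment O(k^4), so exceeding (k + 1)^3 has probability
   O(k^-2), which is summable; yet (k + 1)^3 is negligible against (k + 1)^4. *)
pose c k : R := k.+1%:R ^+ 3.
have c0 k : 0 < c k by rewrite exprn_gt0.
pose dev n h : R := q * (total_age h)%:R - n%:R.
pose A k h := c k < `|dev (k.+1 ^ 4)%N h|.
pose F k := [set w | A k (history (B^~ w) (k.+1 ^ 4)%N)].
have mF k : measurable (F k) by case: (iid (k.+1 ^ 4)%N (A k)).
(* The factor 2 absorbs the successor: (k + 1)^4 + 1 <= 2 (k + 1)^4. *)
pose C : R := 2 * (4 / q ^+ 2).
have C0 : 0 <= C by rewrite mulr_ge0// divr_ge0// sqr_ge0.
have PF k : (Pr (F k) <= (C * (k.+1%:R ^+ 2)^-1)%:E)%E.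
  case: (iid (k.+1 ^ 4)%N (A k)) => _ ->; rewrite lee_fin.
  apply: le_trans (mean_chebyshev _ q01 _ _ _ _ (c0 k)
    (mean_total_age_dev2_le _ q01 q0 _)) _.
  rewrite ler_pdivrMr ?exprn_gt0// /c /C.
  have k0 : k.+1%:R != 0 :> R by rewrite pnatr_eq0.
  rewrite [leRHS](_ : _ = (2 * k.+1%:R ^+ 4) * (4 / q ^+ 2)).
    rewrite ler_wpM2r ?divr_ge0 ?sqr_ge0// -natrX -natrM ler_nat mul2n -addnn.
    by rewrite -[leqLHS]addn1 leq_add2l expn_gt0.
  by field; rewrite gt_eqF//= nat1r.
have F0 : Pr (lim_sup_set F) = 0%E.
  apply: lim_sup_set_cvg0 => //; apply: (@le_lt_trans _ _ (C * 2)%:E); last exact: ltry.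
  apply: lime_le; first exact: is_cvg_nneseries.
  apply: nearW => n; apply: (@le_trans _ _ (\sum_(0 <= k < n) (C * (k.+1%:R ^+ 2)^-1)%:E)%E).
    by apply: lee_sum => k _; exact: PF.
  by rewrite sumEFin lee_fin -mulr_sumr ler_wpM2l// big_mkord sum_inv_sqr_le.
exists (lim_sup_set F); split => //.
  by apply: bigcap_measurable => // n _; exact: bigcup_measurable.
move=> w; apply: contra_notP => nF.
have {nF}[n _ nF] : exists2 n, True & forall j, (n <= j)%N -> ~ F j w.
  apply: contra_notP nF => nF n _; apply: contra_notP nF => nF; exists n => // j nj Fj.
  by apply: nF; exists j.
apply: cvg_mean_along_expn4; first exact: total_age_history_homo.
rewrite -(cvg_shiftS (fun k => (total_age (history (B^~ w) (k ^ 4)%N))%:R / (k ^ 4)%N%:R : R)).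
apply/cvgrPdist_le => e e0; near=> k.
have nk : (n <= k)%N by near: k; exact: nbhs_infty_ge.
have /negP := nF k nk; rewrite -leNgt /dev => h.
have k0 : k.+1%:R != 0 :> R by rewrite pnatr_eq0.
have -> : q^-1 - (total_age (history (B^~ w) (k.+1 ^ 4)%N))%:R / (k.+1 ^ 4)%N%:R =
  - (q * (total_age (history (B^~ w) (k.+1 ^ 4)%N))%:R - (k.+1 ^ 4)%N%:R) / (q * k.+1%:R ^+ 4).
  by rewrite natrX; field; rewrite nat1r pnatr_eq0 lt0r_neq0.
rewrite normrM normrN normfV (gtr0_norm (mulr_gt0 q0 _)) ?exprn_gt0//.
rewrite ler_pdivrMr ?mulr_gt0 ?exprn_gt0// (le_trans h)//.
rewrite [leRHS](_ : _ = (e * q * k.+1%:R) * k.+1%:R ^+ 3); last by ring.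
rewrite ler_peMl ?exprn_ge0//.
rewrite -ler_pdivrMl ?mulr_gt0// mulr1.
apply: (@le_trans _ _ k%:R); last by rewrite ler_nat.
by near: k; exact: nbhs_infty_ger.
Unshelve. all: by end_near.
Qed.

End almost_sure_mean_age.

(** * From slots to continuous time *)

Section time_average.
Context {R : realType}.
Variables (T : R) (B : nat -> bool).
Hypothesis T0 : 0 < T.
Local Notation mu := (@lebesgue_measure R).

(** This is [freshest] for one fixed outcome, with the success bits as an arbitrary sequence. *)
Definition last_generation t : R :=
  sup [set g | exists n, [/\ B n, n.+1%:R * T <= t & g = n%:R * T]].

(** Thus n - a is the last successful slot before n, or 0 if there is none, which agrees with
    [sup set0 = 0]. *)
Lemma age_historyP n : let a := age (history B n) in
  [/\ (a <= n)%N, (forall k, (k < n)%N -> B k -> (k + a <= n)%N) &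
      (0 < a)%N /\ B (n - a)%N \/ (forall k, (k < n)%N -> ~~ B k) /\ a = n].
Proof.
elim: n => [|n [an ub H]] /=; first by split => //; right.
case: ifPn => Bn.
  split=> //; first by move=> k kn _; rewrite addn1.
  by left; rewrite subn1.
split => //.
  move=> k; rewrite ltnS leq_eqVlt => /predU1P[->|kn] Bk; first by rewrite Bk in Bn.
  by rewrite addnS ltnS ub.
case: H => [[a0 Ba]|[nB aE]]; [left|right]; first by rewrite subSS.
split; last by rewrite aE.
by move=> k; rewrite ltnS leq_eqVlt => /predU1P[->//|]; exact: nB.
Qed.

Lemma last_generationE n t : n%:R * T <= t < n.+1%:R * T ->
  last_generation t = (n - age (history B n))%N%:R * T.
Proof.
move=> /andP[nt tn].
have lt_n k : k.+1%:R * T <= t -> (k < n)%N.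
  by move=> /le_lt_trans/(_ tn); rewrite ltr_pM2r// ltr_nat.
rewrite /last_generation; have [an ub [[a0 Ba]|[nB ->]]] := age_historyP n.
- apply/eqP; rewrite eq_le; apply/andP; split.
    apply: ge_sup.
      exists ((n - age (history B n))%N%:R * T), (n - age (history B n))%N; split => //.
      by apply: le_trans nt; rewrite ler_pM2r// ler_nat ltn_subrL a0 (leq_trans a0).
    move=> _ [k [Bk /lt_n kn ->]].
    by rewrite ler_pM2r// ler_nat leq_subRL// addnC ub.
  apply: ub_le_sup.
    by exists (n%:R * T) => _ [k [_ /lt_n/ltnW kn ->]]; rewrite ler_pM2r// ler_nat.
  exists (n - age (history B n))%N; split => //.
  by apply: le_trans nt; rewrite ler_pM2r// ler_nat ltn_subrL a0 (leq_trans a0).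
- rewrite subnn mul0r [X in sup X](_ : _ = set0) ?sup0//.
  rewrite -subset0 => g [k [Bk /lt_n kn _]].
  by move: (nB k kn); rewrite Bk.
Qed.

Lemma last_generation_lt0 t : t < 0 -> last_generation t = 0.
Proof.
move=> t0; rewrite /last_generation [X in sup X](_ : _ = set0) ?sup0//.
rewrite -subset0 => g [k [_ kt _]].
by have := le_lt_trans kt t0; rewrite ltNge mulr_ge0// ltW.
Qed.

Lemma slotP t : 0 <= t -> exists n, n%:R * T <= t < n.+1%:R * T.
Proof.
move=> t0; exists (Num.truncn (t / T)).
have /truncn_itv : 0 <= t / T by rewrite divr_ge0// ltW.
by rewrite ler_pdivlMr// ltr_pdivrMr.
Qed.

Lemma last_generation_ge0 t : 0 <= last_generation t.
Proof.
have [/last_generation_lt0->//|/slotP[n /last_generationE->]] := ltP t 0.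
by rewrite mulr_ge0// ltW.
Qed.

Lemma last_generation_le t : 0 <= t -> last_generation t <= t.
Proof.
move=> /slotP[n h]; rewrite (last_generationE n)//.
by case/andP: h => + _; apply: le_trans; rewrite ler_pM2r// ler_nat leq_subr.
Qed.

(** Monotonicity on the whole line supplies the measurability of the age. *)
Lemma last_generation_nd : nondecreasing_fun last_generation.
Proof.
move=> s t st; have [/last_generation_lt0->|s0] := ltP s 0; first exact: last_generation_ge0.
have [m hm] := slotP s s0; have [n hn] := slotP t (le_trans s0 st).
have [am _ _] := age_historyP m.
have mn : (m <= n)%N.
  rewrite -ltnS -(ltr_nat R) -(ltr_pM2r T0).
  by case/andP: hm => h _; case/andP: hn => _; apply: le_lt_trans; exact: le_trans st.
rewrite (last_generationE m)// (last_generationE n)// ler_pM2r// ler_nat.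
have [_ _ [[a0 Bm]|[_ ->]]] := age_historyP m; last by rewrite subnn.
have [an ub _] := age_historyP n.
rewrite leq_subRL// addnC ub//.
by rewrite (leq_trans _ mn)// ltn_subrL a0 (leq_trans a0).
Qed.

Definition instant_age t : R := t - last_generation t.

Lemma instant_age_ge0 t : 0 <= t -> 0 <= instant_age t.
Proof. by move=> t0; rewrite subr_ge0 last_generation_le. Qed.

Lemma integrable_instant_age a b : 0 <= a -> mu.-integrable `[a, b] (EFin \o instant_age).
Proof.
move=> a0; apply: measurable_bounded_integrable => //=.
- by rewrite lebesgue_measure_itv/=; case: ifPn => // _; rewrite -EFinB ltry.
- apply: measurable_funB => /=; first exact: measurable_id.
  by apply: nondecreasing_measurable => //; exact: last_generation_nd.
- exists b; split; first exact: num_real.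
  move=> M bM t /=; rewrite in_itv/= => /andP[at_ tb].
  have t0 : 0 <= t by exact: le_trans at_.
  rewrite ger0_norm ?instant_age_ge0// (le_trans _ (ltW bM))// (le_trans _ tb)//.
  by rewrite gerBl last_generation_ge0.
Qed.

Definition age_integral x : R := \int[mu]_(t in `[0, x]) instant_age t.

Lemma age_integralB x y : 0 <= x <= y ->
  age_integral y - age_integral x = \int[mu]_(t in `]x, y]) instant_age t.
Proof.
move=> /andP[x0 xy]; apply: Rintegral_itvB; rewrite ?bnd_simp//.
exact: integrable_instant_age.
Qed.

Lemma age_integral_homo x y : 0 <= x <= y -> age_integral x <= age_integral y.
Proof.
move=> /[dup] /andP[x0 _] xy; rewrite -subr_ge0 age_integralB//.
apply: Rintegral_ge0 => t /=; rewrite in_itv/= => /andP[xt _].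
by rewrite instant_age_ge0// (le_trans x0 (ltW xt)).
Qed.

Lemma Rintegral_affine (a b c : R) : a < b ->
  \int[mu]_(t in `[a, b]) (t - c) = (b ^+ 2 - a ^+ 2) / 2 - c * (b - a).
Proof.
move=> ab; pose F t : R := 2^-1 * t ^+ 2 - c * t.
have dF (t : R) : is_derive t 1 F (t - c).
  have d := is_deriveB (is_deriveZ 2^-1 (is_deriveX 2 (is_derive_id t 1)))
    (is_deriveZ c (is_derive_id t 1)).
  by apply: (@is_derive_eq _ _ _ _ _ _ _ _ d); rewrite /GRing.scale /=; field.
have cF : continuous F.
  by move=> t; apply/differentiable_continuous/derivable1_diffP; case: (dF t).
rewrite /Rintegral (@continuous_FTC2 _ _ F)//.
- by rewrite -EFinB /= /F; field.
- apply: continuous_subspaceT => t.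
  by apply: cvgB; [exact: cvg_id|exact: cvg_cst].
- split=> [t _||]; first by case: (dF t).
  + exact/cvg_at_right_filter/cF.
  + exact/cvg_at_left_filter/cF.
- by move=> t _; rewrite derive1E; case: (dF t).
Qed.

Lemma Rintegral_itv_oc (f : R -> R) (a b : R) : mu.-integrable `[a, b] (EFin \o f) ->
  \int[mu]_(t in `]a, b]) f t = \int[mu]_(t in `]a, b[) f t.
Proof.
move=> fi; rewrite -Rintegral_itv_bndo_bndc//.
by apply: integrableS fi => //; apply: subset_itv; rewrite bnd_simp.
Qed.

(** During slot n the age grows linearly from A T to (A + 1) T, where A is the age of the first n
    bits, so the slot contributes T^2 (A + 1 / 2). *)
Lemma age_integral_slot n :
  age_integral (n%:R * T) = T ^+ 2 * ((total_age (history B n))%:R + n%:R / 2).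
Proof.
elim: n => [|n IH].
  by rewrite mul0r /age_integral set_itv1 Rintegral_set1 mul0r addr0 mulr0.
have nT : n%:R * T < n.+1%:R * T by rewrite ltr_pM2r// ltr_nat.
have nT0 : 0 <= n%:R * T by rewrite mulr_ge0// ltW.
rewrite -[LHS](subrK (age_integral (n%:R * T))) age_integralB ?nT0 ?ltW//.
(* The right endpoint is dropped because an update received exactly then already lowers the age; a
   single point does not change the integral. *)
rewrite Rintegral_itv_oc; last exact: integrable_instant_age.
have -> : \int[mu]_(t in `]n%:R * T, n.+1%:R * T[) instant_age t =
    \int[mu]_(t in `]n%:R * T, n.+1%:R * T[) (t - (n - age (history B n))%N%:R * T).
  apply: eq_Rintegral => t; rewrite inE/= in_itv/= => /andP[nt tn].
  by rewrite /instant_age (last_generationE n)// tn ltW.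
have gi : mu.-integrable `[n%:R * T, n.+1%:R * T]
    (EFin \o (fun t : R => t - (n - age (history B n))%N%:R * T)).
  apply: continuous_compact_integrable; first exact: segment_compact.
  apply: continuous_subspaceT => t.
  by apply: cvgB; [exact: cvg_id|exact: cvg_cst].
rewrite -Rintegral_itv_oc// Rintegral_itv_obnd_cbnd; last first.
  by apply: integrableS gi => //; apply: subset_itv; rewrite bnd_simp.
rewrite Rintegral_affine// IH /= natrD.
have [an _ _] := age_historyP n; by rewrite natrB// -natr1; field.
Qed.

(** [J n] is the average at time n T. For n T <= x < (n + 1) T, monotonicity of the integral bounds
    the average at x by [J n] times n / (n + 1) and [J n.+1] times (n + 1) / n. *)
Lemma cvg_average_age (l : R) :
  (total_age (history B n))%:R / n%:R @[n --> \oo] --> l ->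
  x^-1 * age_integral x @[x --> +oo] --> T * (l + 2^-1).
Proof.
move=> cl.
pose J n : R := T * ((total_age (history B n))%:R / n%:R + 2^-1).
have cJ : J n @[n --> \oo] --> T * (l + 2^-1).
  by apply: cvgM; [exact: cvg_cst|apply: cvgD => //; exact: cvg_cst].
have JE n : (0 < n)%N -> age_integral (n%:R * T) = J n * (n%:R * T).
  move=> n0; rewrite age_integral_slot /J; field.
  by rewrite pnatr_eq0 -lt0n.
have cr : n.+1%:R / n%:R @[n --> \oo] --> (1 : R).
  rewrite -(cvg_shiftS (fun n => n.+1%:R / n%:R : R)).
  have -> : (fun n => n.+2%:R / n.+1%:R) = fun n => 1 + n.+1%:R^-1 :> R.
    by apply/funext => n; rewrite -[n.+2%:R]natr1 mulrDl divff ?div1r// pnatr_eq0.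
  suff : (1 + n.+1%:R^-1 : R) @[n --> \oo] --> (1 + 0 : R) by rewrite addr0.
  by apply: cvgD; [exact: cvg_cst|exact: cvg_harmonic].
have cu : J n.+1 * (n.+1%:R / n%:R) @[n --> \oo] --> T * (l + 2^-1).
  suff : J n.+1 * (n.+1%:R / n%:R) @[n --> \oo] --> T * (l + 2^-1) * 1 by rewrite mulr1.
  by apply: cvgM => //; rewrite (cvg_shiftS J).
have cd : J n * (n.+1%:R / n%:R)^-1 @[n --> \oo] --> T * (l + 2^-1).
  suff : J n * (n.+1%:R / n%:R)^-1 @[n --> \oo] --> T * (l + 2^-1) * 1^-1.
    by rewrite invr1 mulr1.
  by apply: cvgM => //; apply: cvgV => //; exact: oner_neq0.
apply/cvgrPdist_le => e e0.
move/cvgrPdist_le : cu => /(_ e e0)[K1 _ HK1].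
move/cvgrPdist_le : cd => /(_ e e0)[K2 _ HK2].
near=> x.
have xK : (maxn 1 (maxn K1 K2))%:R * T <= x by near: x; apply: nbhs_pinfty_ge; exact: num_real.
have x0 : 0 < x by apply: lt_le_trans xK; rewrite mulr_gt0// ltr0n leq_max.
have [n /andP[nx xn]] := slotP x (ltW x0).
have : (maxn 1 (maxn K1 K2) <= n)%N.
  by rewrite -ltnS -(ltr_nat R) -(ltr_pM2r T0) (le_lt_trans xK).
rewrite !geq_max => /and3P[n0 nK1 nK2].
have /= := HK1 n nK1; have /= := HK2 n nK2.
have nT0 : 0 < n%:R * T by rewrite mulr_gt0// ltr0n.
have hu : x^-1 * age_integral x <= J n.+1 * (n.+1%:R / n%:R).
  have -> : J n.+1 * (n.+1%:R / n%:R) = (n%:R * T)^-1 * age_integral (n.+1%:R * T).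
    by rewrite JE//; field; rewrite !gt_eqF// ltr0n.
  apply: ler_pM; rewrite ?invr_ge0 ?lef_pV2 ?posrE ?(ltW x0)//.
    by apply: Rintegral_ge0 => t /=; rewrite in_itv/= => /andP[/instant_age_ge0].
  by rewrite age_integral_homo// !ltW.
have hd : J n * (n.+1%:R / n%:R)^-1 <= x^-1 * age_integral x.
  have -> : J n * (n.+1%:R / n%:R)^-1 = (n.+1%:R * T)^-1 * age_integral (n%:R * T).
    by rewrite JE//; field; rewrite !gt_eqF ?ltr0n.
  have xn0 : 0 < n.+1%:R * T by exact: lt_trans xn.
  apply: ler_pM; rewrite ?invr_ge0 ?lef_pV2 ?posrE ?(ltW xn0) ?(ltW xn)//.
    by apply: Rintegral_ge0 => t /=; rewrite in_itv/= => /andP[/instant_age_ge0].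
  by rewrite age_integral_homo// (ltW nT0).
rewrite !ler_norml => /andP[_ h2] /andP[h1 _].
by apply/andP; split; [apply: le_trans h1 _|apply: le_trans _ h2]; rewrite lerD2l lerN2.
Unshelve. all: by end_near.
Qed.

End time_average.

(** * The success bits of the model *)

Section finite_fibers.
Context {d : measure_display} {Om : measurableType d} {R : realType} {C : finType}.
Implicit Types (f : Om -> C) (D : set Om).

Lemma measurable_fibers f D :
  (forall c, measurable (D `&` [set w | f w = c])) -> measurable D.
Proof.
move=> mD; rewrite (_ : D = \bigcup_(c in [set: C]) (D `&` [set w | f w = c])).
  by apply: fin_bigcup_measurable => //; exact: finite_finset.
by apply/seteqP; split=> [w Dw|w [c _ []]//]; exists (f w).
Qed.

Lemma measure_fibers (mu : {measure set Om -> \bar R}) f D :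
  (forall c, measurable (D `&` [set w | f w = c])) ->
  mu D = (\sum_(c : C) mu (D `&` [set w | f w = c]))%E.
Proof.
move=> mD; rewrite [in LHS](_ : D = \bigcup_(c in [set: C]) (D `&` [set w | f w = c])).
  rewrite measure_fin_bigcup//; first last.
  - by move=> c c' _ _ [w [[_ /= <-] [_ /= <-]]].
  - exact: finite_finset.
  rewrite [RHS]fsbig_seq ?index_enum_uniq//.
  rewrite (_ : [set` index_enum C] = [set: C])//.
  by apply/seteqP; split=> c //= _; exact: mem_index_enum.
by apply/seteqP; split=> [w Dw|w [c _ []]//]; exists (f w).
Qed.

End finite_fibers.

(** * Independent draws from a finite set give independent bits *)

Section iid_draws.
Context {d : measure_display} {Om : measurableType d} {R : realType} {C : finType}.
Variables (Pr : probability Om R) (draw : nat -> Om -> C) (law : C -> R).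

Definition draws_are n (l : seq C) : set Om :=
  [set w | [seq draw k w | k <- iota n (size l)] = l].

Hypothesis measurable_draw : forall k c, measurable [set w | draw k w = c].
Hypothesis draws_law : forall l, Pr (draws_are 0 l) = (\prod_(c <- l) law c)%:E.

Lemma draws_are_cons n c l :
  draws_are n (c :: l) = [set w | draw n w = c] `&` draws_are n.+1 l.
Proof.
by apply/seteqP; split=> w [h1 h2]; [split|rewrite /draws_are /= h1 h2].
Qed.

Lemma measurable_draws_are n l : measurable (draws_are n l).
Proof.
elim: l n => [|c l IH] n; last by rewrite draws_are_cons; exact: measurableI.
by rewrite (_ : draws_are n [::] = setT)//; apply/seteqP.
Qed.

Lemma law_ge0 c : 0 <= law c.
Proof. by have := draws_law [:: c]; rewrite big_seq1 -lee_fin => <-. Qed.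

Lemma sum_law : \sum_c law c = 1.
Proof.
apply: EFin_inj; rewrite -(@probability_setT _ _ _ Pr) -sumEFin.
rewrite (measure_fibers Pr (draw 0%N)); last by move=> c; rewrite setTI.
apply: eq_bigr => c _; have := draws_law [:: c]; rewrite big_seq1 => <-.
congr (Pr _); apply/seteqP; split=> w; first by case=> h; split.
by case=> _ /= h; rewrite /draws_are /= h.
Qed.

Variable good : pred C.

Let q := \sum_(c | good c) law c.
Let B n w := good (draw n w).

Lemma prob_good_le1 : q <= 1.
Proof.
rewrite -sum_law [leRHS](bigID good)/= lerDl.
by apply: sumr_ge0 => c _; exact: law_ge0.
Qed.

(** Fixing the draws [l] that follow the history makes the induction work: splitting on the value c
    of the newest draw moves that draw from the history to the front of [l]. *)
Lemma measure_history n (A : pred (seq bool)) l :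
  measurable ([set w | A (history (B^~ w) n)] `&` draws_are n l) /\
  Pr ([set w | A (history (B^~ w) n)] `&` draws_are n l) =
  (mean q n (fun h => (A h)%:R) * \prod_(c <- l) law c)%:E.
Proof.
elim: n A l => [|n IH] A l /=.
  have [Anil|nA] := boolP (A [::]).
    rewrite (_ : [set _ | _] = setT) ?setTI ?mul1r; last exact/seteqP.
    by split; [exact: measurable_draws_are|exact: draws_law].
  rewrite (_ : [set _ | _] = set0) ?set0I ?measure0 ?mul0r//.
  by apply/seteqP; split.
have fiber c : [set w | A (B n w :: history (B^~ w) n)] `&` draws_are n.+1 l
      `&` [set w | draw n w = c] =
    [set w | A (good c :: history (B^~ w) n)] `&` draws_are n (c :: l).
  rewrite draws_are_cons; apply/seteqP; split=> w /=.
    by move=> [[Aw lw] cw]; rewrite -cw.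
  by move=> [Aw [cw lw]]; rewrite /B cw.
have mfib c : measurable ([set w | A (B n w :: history (B^~ w) n)] `&` draws_are n.+1 l
      `&` [set w | draw n w = c]).
  by rewrite fiber; case: (IH (fun h => A (good c :: h)) (c :: l)).
split; first exact: measurable_fibers mfib.
rewrite (measure_fibers Pr (draw n))//.
rewrite (eq_bigr (fun c => (law c * mean q n (fun h => (A (good c :: h))%:R) *
    \prod_(c <- l) law c)%:E)); last first.
  move=> c _; rewrite fiber; apply: etrans (proj2 (IH (fun h => A (good c :: h)) (c :: l))) _.
  by rewrite big_cons; congr EFin; ring.
rewrite sumEFin -mulr_suml; congr (_ * _)%:E.
have qC : \sum_(c | ~~ good c) law c = 1 - q.
  by rewrite -sum_law [X in _ = X - _](bigID good)/= addrC addrK.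
rewrite meanD !meanZ (bigID good)/= -qC [in RHS]/q !mulr_suml.
congr (_ + _); first by apply: eq_bigr => c ->.
by apply: eq_bigr => c /negbTE ->.
Qed.

Lemma iid_bits_good : iid_bits Pr B q.
Proof.
move=> n A; have [] := measure_history n A [::].
by rewrite big_nil mulr1 (_ : draws_are n [::] = setT) ?setIT//; apply/seteqP.
Qed.

End iid_draws.

(* What user i does in a slot: ((attempt, high), (P_1 feasible, P_2 feasible)). *)
Notation action := ((bool * bool) * (bool * bool))%type.

Definition gain_component (R : realType) : subprobability _ R :=
  (normal_prob 0 (Num.sqrt (2^-1 : R)) : probability _ R).

(** The product measure of [gain_law], packaged as a subprobability so that its values are known to
    be finite. *)
Definition gain_distribution (R : realType) : subprobability _ R :=
  product_subprobability (gain_component R, gain_component R).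

(** * The joint law of the actions of all users *)

Section slot_actions.
Context {R : realType} {M : nat} {ptx : R}.
Variable X : noma_model M ptx.
Variables (rate P : R).
Hypothesis ptx01 : 0 <= ptx <= 1.

(** A gain matters only through its two feasibility bits. Cutting the plane accordingly makes the
    outcome of a slot range over a finite type. *)
Definition gain_region (f : bool * bool) : set (R * R) :=
  [set g | (rx_level M rate true <= P * (g.1 ^+ 2 + g.2 ^+ 2),
            rx_level M rate false <= P * (g.1 ^+ 2 + g.2 ^+ 2)) = f].

Definition gain_region_prob f : R := fine (gain_distribution R (gain_region f)).

Definition action_law (v : action) : R :=
  gain_region_prob v.2 * (bernoulli_pmf 2^-1 v.1.2 * bernoulli_pmf ptx v.1.1).

Definition actions n (w : Om X) : {ffun 'I_M -> action} :=
  [ffun i => ((attempt X i n w, high X i n w),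
              (feasible rate P n w true i, feasible rate P n w false i))].

Lemma measurable_feasible_gain b :
  measurable [set g : R * R | rx_level M rate b <= P * (g.1 ^+ 2 + g.2 ^+ 2)].
Proof.
rewrite -[X in measurable X]setTI.
apply: measurable_fun_le => //.
apply: measurable_funM => //.
by apply: measurable_funD; apply: measurable_funX.
Qed.

Lemma measurable_gain_region f : measurable (gain_region f).
Proof.
case: f => f1 f2.
have h b f : measurable [set g : R * R | (rx_level M rate b <= P * (g.1 ^+ 2 + g.2 ^+ 2)) = f].
  case: f; first exact: measurable_feasible_gain.
  rewrite (_ : mkset _ = ~` [set g : R * R | rx_level M rate b <= P * (g.1 ^+ 2 + g.2 ^+ 2)]).
    by apply: measurableC; exact: measurable_feasible_gain.
  by apply/seteqP; split=> g /=; [move=> ->|move/negP/negbTE].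
rewrite (_ : gain_region _ =
    [set g : R * R | (rx_level M rate true <= P * (g.1 ^+ 2 + g.2 ^+ 2)) = f1] `&`
    [set g : R * R | (rx_level M rate false <= P * (g.1 ^+ 2 + g.2 ^+ 2)) = f2]).
  exact: measurableI.
by apply/seteqP; split=> g; [case=> <- <-|case=> /= h1 h2; rewrite /gain_region /= h1 h2].
Qed.

Lemma gain_region_probE f : gain_distribution R (gain_region f) = (gain_region_prob f)%:E.
Proof.
rewrite fineK// fin_num_measure//; exact: measurable_gain_region.
Qed.

Lemma bernoulli_prob1 (p : R) b : 0 <= p <= 1 ->
  bernoulli_prob p [set b] = (bernoulli_pmf p b)%:E.
Proof. by move=> p01; rewrite /bernoulli_prob p01 fsbig_set1. Qed.

(** The index [k] follows the numbering in [draws_independent]: gain, level, attempt. *)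
Definition action_event n (v : action) (i : 'I_M) (k : 'I_3) : set (Om X) :=
  match val k with
  | 0%N => gain X i n @^-1` gain_region v.2
  | 1%N => high X i n @^-1` [set v.1.2]
  | _ => attempt X i n @^-1` [set v.1.1]
  end.

Definition action_factor (v : action) (k : 'I_3) : R :=
  match val k with
  | 0%N => gain_region_prob v.2
  | 1%N => bernoulli_pmf 2^-1 v.1.2
  | _ => bernoulli_pmf ptx v.1.1
  end.

Lemma prod_action_factor v : \prod_(k < 3) action_factor v k = action_law v.
Proof. by rewrite !big_ord_recl big_ord0 mulr1. Qed.

Lemma prob_action_event n v i k : Pr X (action_event n v i k) = (action_factor v k)%:E.
Proof.
case: k => -[|[|[|k]]] // k3; rewrite /action_event /action_factor /=.
- have := gain_law X i n (measurable_gain_region v.2); rewrite /distribution /pushforward => ->.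
  exact: gain_region_probE.
- have := high_law X i n [set v.1.2]; rewrite /distribution /pushforward => ->.
  by rewrite bernoulli_prob1// invr_ge0 ler0n /= invf_le1// ler1n.
- have := attempt_law X i n [set v.1.1]; rewrite /distribution /pushforward => ->.
  exact: bernoulli_prob1.
Qed.

Lemma measurable_action_event n v i k : measurable (action_event n v i k).
Proof.
case: k => -[|[|[|k]]] // k3; rewrite /action_event /=; rewrite -[X in measurable X]setTI.
- by apply: (measurable_funPT (gain X i n)) => //; exact: measurable_gain_region.
- exact: (measurable_funPT (high X i n)).
- exact: (measurable_funPT (attempt X i n)).
Qed.

Lemma actionsP n c w : actions n w = c <-> forall i k, action_event n (c i) i k w.
Proof.
split=> [<- i [[|[|[|k]]] //] k3|h]; rewrite /action_event /= ?ffunE//.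
apply/ffunP => i; rewrite ffunE.
have h0 := h i (@Ordinal 3 0 isT).
have h1 := h i (@Ordinal 3 1 isT).
have h2 := h i (@Ordinal 3 2 isT).
move: h0 h1 h2; rewrite /action_event /= /gain_region /= => h0 h1 h2.
by rewrite /feasible h0 h1 h2; case: (c i) => -[].
Qed.

Lemma measurable_actions n c : measurable [set w | actions n w = c].
Proof.
rewrite (_ : mkset _ = \bigcap_(x in [set: 'I_M * 'I_3]) action_event n (c x.1) x.1 x.2).
  apply: fin_bigcap_measurable; first exact: finite_finset.
  by move=> x _; exact: measurable_action_event.
apply/seteqP; split=> w; first by move=> /actionsP h x _; exact: h.
by move=> h; apply/actionsP => i k; exact: (h (i, k)).
Qed.

(** Mutual independence is applied once, to all triples of user, slot and kind of draw occurring in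
    [l]; the product is then regrouped by slot and by user. *)
Lemma prob_actions (l : seq {ffun 'I_M -> action}) :
  Pr X (draws_are actions 0 l) = (\prod_(c <- l) \prod_i action_law (c i))%:E.
Proof.
pose c0 : {ffun 'I_M -> action} := [ffun=> ((true, true), (true, true))].
pose E (x : 'I_M * nat * 'I_3) := action_event x.1.2 (nth c0 l x.1.2 x.1.1) x.1.1 x.2.
pose phi (x : 'I_(size l) * ('I_M * 'I_3)) : 'I_M * nat * 'I_3 := (x.2.1, val x.1, x.2.2).
have phi_inj : injective phi by move=> [n [i k]] [n' [i' k']] [-> /val_inj -> ->].
pose J : {fset 'I_M * nat * 'I_3} :=
  [fset phi x | x in {: 'I_(size l) * ('I_M * 'I_3)}]%fset.
have JP x : [set` J] x <-> exists y, phi y = x.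
  split=> [/=/imfsetP[y _ ->]|[y <-]]; first by exists y.
  by apply/imfsetP; exists y.
have := @draws_independent _ _ _ X J E.
have -> : \bigcap_(x in [set` J]) E x = draws_are actions 0 l.
  apply/seteqP; split=> w.
    move=> h; apply: (@eq_from_nth _ c0); first by rewrite size_map size_iota.
    rewrite size_map size_iota => n nl; rewrite (nth_map 0%N) ?size_iota// nth_iota//.
    apply/actionsP => i k; apply: (h (i, n, k)); apply/JP.
    by exists (Ordinal nl, (i, k)).
  move=> h x /JP[[n [i k]] <-]; apply: (proj1 (actionsP _ _ _)).
  have /= := congr1 (fun s => nth c0 s n) h.
  by rewrite (nth_map 0%N) ?size_iota// nth_iota.
move=> ->; last first.
  move=> [[i n] k] _; rewrite /E /action_event /=.
  case: k => -[|[|[|k]]] // k3; rewrite /generated_events /preimage_set_system /=.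
  - by exists (gain_region (nth c0 l n i).2); [exact: measurable_gain_region|rewrite setTI].
  - by exists [set (nth c0 l n i).1.2]; rewrite ?setTI.
  - by exists [set (nth c0 l n i).1.1]; rewrite ?setTI.
(* As [phi] is injective, the product over the finite set [J] is a product over slots, users and
   kinds, without repetition. *)
rewrite (perm_big (map phi (index_enum _)))/=; last first.
  apply: uniq_perm => [||x]; first exact: fset_uniq.
    by rewrite map_inj_uniq ?index_enum_uniq.
  apply/idP/mapP => [/JP[y <-]|[y _ ->]]; last by apply/JP; exists y.
  by exists y => //; exact: mem_index_enum.
rewrite big_map.
rewrite (eq_bigr (fun x : 'I_(size l) * ('I_M * 'I_3) =>
    (action_factor (nth c0 l x.1 x.2.1) x.2.2)%:E)); last first.
  by move=> [n [i k]] _; exact: prob_action_event.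
rewrite prodEFin; congr EFin.
rewrite -(pair_bigA _ (fun n x => action_factor (nth c0 l (nat_of_ord n) x.1) x.2))/=.
rewrite [RHS](big_nth c0) big_mkord; apply: eq_bigr => n _.
rewrite -(pair_bigA _ (fun i k => action_factor (nth c0 l n i) k))/=.
by apply: eq_bigr => i _; exact: prod_action_factor.
Qed.

End slot_actions.

(** * The probability of being decoded by SIC *)

Section sic_decoding.
Local Open Scope set_scope.
Context {R : realType} {V : finType} {m : nat}.
Variables (law : V -> R) (t1 t2 : pred V) (i : 'I_m.+1).
Hypothesis sum_law1 : \sum_v law v = 1.
Hypothesis t12 : forall v, t1 v -> ~~ t2 v.
Implicit Types c : {ffun 'I_m.+1 -> V}.

Definition decoded c : bool :=
  (t1 (c i) && (#|[pred j | t1 (c j)]| == 1)) ||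
  [&& (#|[pred j | t1 (c j)]| <= 1)%N, t2 (c i) & #|[pred j | t2 (c j)]| == 1].

Let senders (t : pred V) c := [set j | t (c j)].

Lemma only_sender t c : t (c i) && (#|[pred j | t (c j)]| == 1) = (senders t c == [set i]).
Proof.
rewrite -cardsE; apply/idP/eqP => [/andP[ti /cards1P[k tk]]|h].
  have : i \in senders t c by rewrite inE.
  by rewrite {1 2}/senders tk inE => /eqP ->.
rewrite -/(senders t c) h cards1 eqxx andbT.
have : i \in senders t c by rewrite h inE.
by rewrite inE.
Qed.

Lemma decodedE c : decoded c = (senders t1 c == [set i]) ||
  (senders t2 c == [set i]) && (#|senders t1 c| <= 1)%N.
Proof.
by rewrite /decoded -!only_sender /senders cardsE [_ && (_ <= 1)%N]andbC.
Qed.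

Let idle : pred V := [pred v | ~~ t1 v && ~~ t2 v].

(** Success of user i splits into boxes that constrain each user separately: i alone at the first
    level; i at the second with all others idle; i at the second, k at the first and the rest idle.
    The probability of a box is a product over users. *)
Let high_only j : pred V := if j == i then t1 else predC t1.
Let low_only j : pred V := if j == i then t2 else idle.
Let one_each k j : pred V := if j == i then t2 else if j == k then t1 else idle.

Lemma high_onlyE c : (c \in family high_only) = (senders t1 c == [set i]).
Proof.
apply/familyP/eqP => [h|/setP h j].
  apply/setP => j; have : high_only j (c j) := h j; rewrite !inE /high_only.
  by have [->|_ /negbTE] := eqVneq j i.
suff : high_only j (c j) by [].
have := h j; rewrite !inE /high_only.
by have [->|_ /negbT] := eqVneq j i.
Qed.

Lemma low_onlyE c : (c \in family low_only) =
  (senders t2 c == [set i]) && (senders t1 c == finset.set0).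
Proof.
apply/familyP/andP => [h|[/eqP/setP h2 /eqP/setP h1] j].
  split; apply/eqP/setP => j; have : low_only j (c j) := h j; rewrite !inE /low_only.
    by have [->|_ /andP[_ /negbTE]] := eqVneq j i.
  have [->|_ /andP[/negbTE]//] := eqVneq j i.
  by move=> t2i; apply/negP => /t12; rewrite t2i.
suff : low_only j (c j) by [].
have := h2 j; have := h1 j; rewrite !inE /low_only.
by have [->|_ e1 e2] := eqVneq j i; rewrite /idle /= ?e1 ?e2.
Qed.

Lemma one_eachE k c : k != i -> (c \in family (one_each k)) =
  (senders t2 c == [set i]) && (senders t1 c == [set k]).
Proof.
move=> ki; apply/familyP/andP => [h|[/eqP/setP h2 /eqP/setP h1] j].
  split; apply/eqP/setP => j; have : one_each k j (c j) := h j; rewrite !inE /one_each.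
    have [->//|_] := eqVneq j i; have [_ /t12/negbTE//|_] := eqVneq j k.
    by move=> /andP[_ /negbTE].
  have [->|_] := eqVneq j i.
    by rewrite eq_sym (negbTE ki) => t2i; apply/negP => /t12; rewrite t2i.
  by have [_|_ /andP[/negbTE]] := eqVneq j k.
suff : one_each k j (c j) by [].
have := h2 j; have := h1 j; rewrite !inE /one_each.
have [->//|_] := eqVneq j i.
by have [_|_ e1 e2] := eqVneq j k; rewrite /idle /= ?e1 ?e2.
Qed.

(** The boxes are pairwise disjoint: they differ in the set of senders at the first level, or in
    whether i sends at the second, so at most one summand is nonzero. *)
Lemma decoded_sum (x : R) c : (if decoded c then x else 0) =
  (if c \in family high_only then x else 0) + (if c \in family low_only then x else 0) +
  \sum_(k | k != i) (if c \in family (one_each k) then x else 0).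
Proof.
rewrite decodedE high_onlyE low_onlyE.
under eq_bigr => k ki do rewrite one_eachE//.
have [s1|s1] := eqVneq (senders t1 c) [set i].
  have -> : (senders t2 c == [set i]) = false.
    apply/negP => /eqP /setP/(_ i); rewrite !inE eqxx => t2i.
    by move/setP/(_ i): s1; rewrite !inE eqxx => /t12; rewrite t2i.
  by rewrite big1// !addr0.
have [s2|s2] /= := eqVneq (senders t2 c) [set i]; last by rewrite big1// !addr0.
have [s0|s0] := eqVneq (senders t1 c) finset.set0.
  rewrite s0 cards0 /= big1 ?addr0 ?add0r// => k _; case: eqP => // /setP/(_ k).
  by rewrite !inE eqxx.
rewrite leq_eqVlt ltnS leqn0 cards_eq0 (negbTE s0) orbF !add0r.
case: ifPn => [/cards1P[k s1k]|n1].
  have ki : k != i by apply: contra_neq s1 => <-.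
  rewrite (bigD1 k)//= s1k eqxx big1 ?addr0// => k' /andP[_ k'k].
  by case: eqP => // /set1_inj kk'; rewrite kk' eqxx in k'k.
rewrite big1// => k _; case: eqP => // s1k.
by rewrite s1k cards1 in n1.
Qed.

(** Summing a product over a box gives the product of the sums. The m boxes indexed by k all have
    the same weight, whence the factor m. *)
Lemma sum_decoded : \sum_(c | decoded c) \prod_j law (c j) =
  success_prob m (\sum_(v | t1 v) law v) (\sum_(v | t2 v) law v).
Proof.
set a := \sum_(v | t1 v) _; set b := \sum_(v | t2 v) _.
have a' : \sum_(v | predC t1 v) law v = 1 - a.
  by rewrite -sum_law1 [X in _ = X - _](bigID t1)/= addrC addrK.
have ab' : \sum_(v | idle v) law v = 1 - a - b.
  rewrite -a' [X in _ = X - _](bigID t2)/= [X in X + _ - _](_ : _ = b).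
    by rewrite addrC addKr.
  apply: eq_bigl => v; rewrite andbC; case t2v : (t2 v) => //=.
  by apply/negP => /t12; rewrite t2v.
have box (D : 'I_m.+1 -> pred V) :
    \sum_c (if c \in family D then \prod_j law (c j) else 0) =
    \prod_j \sum_(v | D j v) law v.
  by rewrite bigA_distr_big_dep [RHS]big_mkcond.
rewrite big_mkcond/=; under eq_bigr => c _ do rewrite decoded_sum.
rewrite !big_split/= exchange_big/= !box.
have prodc (Q : pred 'I_m.+1) (x : R) : \prod_(j | Q j) x = x ^+ #|Q|.
  by rewrite -prodr_const; exact: eq_bigl.
have cardi : #|[pred j | j != i]| = m.
  by have := cardC1 i; rewrite card_ord /=; apply: etrans; apply: eq_card => j; rewrite !inE.
rewrite /success_prob; congr (_ + _ + _).
- rewrite (bigD1 i)//= /high_only eqxx [X in _ * X](eq_bigr (fun=> 1 - a)).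
    by rewrite prodc cardi.
  by move=> j /negbTE ->.
- rewrite (bigD1 i)//= /low_only eqxx [X in _ * X](eq_bigr (fun=> 1 - a - b)).
    by rewrite prodc cardi.
  by move=> j /negbTE ->.
- rewrite (eq_bigr (fun=> a * b * (1 - a - b) ^+ m.-1)).
    rewrite -[X in _ = X%:R * _]cardi mulr_natl -sumr_const.
    exact: eq_bigl.
  move=> k ki; rewrite box (bigD1 i)//= (bigD1 k)//= /one_each eqxx (negbTE ki) eqxx.
  rewrite [X in _ * (_ * X)](eq_bigr (fun=> 1 - a - b)); last first.
    by move=> j /andP[/negbTE -> /negbTE ->].
  rewrite prodc mulrA [b * a]mulrC; congr (_ * _ ^+ _).
  have := cardD1 k [pred j | j != i]; rewrite cardi inE ki add1n.
  move=> /(congr1 predn)/esym; apply: etrans.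
  by apply: eq_card => j; rewrite !inE andbC.
Qed.

End sic_decoding.

(** * The limit of unbounded power *)

Section feasibility.
Context {R : realType} {M : nat}.
Variable rate : R.

Local Notation region P f := (@gain_region R M rate P f).
Local Notation region_prob P f := (@gain_region_prob R M rate P f).

Definition level_of (b : bool) (f : bool * bool) : bool := if b then f.1 else f.2.

Lemma normal_prob_centered_itv_le (s e : R) : s != 0 -> 0 < e ->
  (normal_prob 0 s `](- e)%R, e[ <= (normal_peak s * (2 * e))%:E)%E.
Proof.
move=> s0 e0; rewrite /normal_prob.
apply: (@le_trans _ _ (\int[lebesgue_measure]_(x in `](- e)%R, e[) (normal_peak s)%:E)%E).
  apply: ge0_le_integral => //=.
  - by move=> x _; rewrite lee_fin normal_pdf_ge0.
  - apply/measurable_EFinP; apply: measurable_funTS. exact: measurable_normal_pdf.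
  - by move=> x _; rewrite lee_fin normal_pdf_ub.
rewrite integral_cst//= lebesgue_measure_itv/= lte_fin gtrN// -EFinB -EFinM.
by rewrite opprK mulr2n mulrDl mul1r.
Qed.

Lemma measurable_infeasible_gain (P : R) b :
  measurable [set g : R * R | ~~ (rx_level M rate b <= P * (g.1 ^+ 2 + g.2 ^+ 2))].
Proof.
rewrite (_ : mkset _ = ~` [set g : R * R | rx_level M rate b <= P * (g.1 ^+ 2 + g.2 ^+ 2)]).
  by apply: measurableC; exact: measurable_feasible_gain.
by apply/seteqP; split=> g /= /negP.
Qed.

Definition infeasible_prob (P : R) b : R :=
  fine (gain_distribution R [set g | ~~ (rx_level M rate b <= P * (g.1 ^+ 2 + g.2 ^+ 2))]).

Lemma infeasible_probE P b :
  infeasible_prob P b = \sum_(f | ~~ level_of b f) region_prob P f.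
Proof.
pose act (g : R * R) := (rx_level M rate true <= P * (g.1 ^+ 2 + g.2 ^+ 2),
                         rx_level M rate false <= P * (g.1 ^+ 2 + g.2 ^+ 2)).
set D := [set g : R * R | ~~ (rx_level M rate b <= P * (g.1 ^+ 2 + g.2 ^+ 2))].
have DE f : D `&` [set g | act g = f] = if ~~ level_of b f then region P f else set0.
  apply/seteqP; split=> g /=.
    by move=> [Dg gf]; move: Dg; rewrite /D -gf /=; case: b @D => /= ->.
  case: ifPn => // fb gf; split => //; move: fb; rewrite -gf /D /=.
  by case: b @D.
have mD f : measurable (D `&` [set g | act g = f]).
  by rewrite DE; case: ifP => // _; exact: measurable_gain_region.
rewrite /infeasible_prob (measure_fibers (gain_distribution R) act)//.
under eq_bigr => f _ do rewrite DE.
rewrite [RHS]big_mkcond/= (eq_bigr (fun f => (if ~~ level_of b f then region_prob P f else 0)%:E)).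
  by rewrite sumEFin.
by move=> f _; case: ifP => _; rewrite ?measure0// gain_region_probE.
Qed.

Lemma gain_distributionT : gain_distribution R [set: R * R] = 1%:E.
Proof.
rewrite -setXTT /gain_distribution /= product_measure1E//.
by rewrite /gain_component /= !probability_setT mule1.
Qed.

Lemma sum_gain_region_prob P : \sum_f region_prob P f = 1.
Proof.
apply: EFin_inj; rewrite -sumEFin -gain_distributionT.
pose act (g : R * R) := (rx_level M rate true <= P * (g.1 ^+ 2 + g.2 ^+ 2),
                         rx_level M rate false <= P * (g.1 ^+ 2 + g.2 ^+ 2)).
rewrite (measure_fibers (gain_distribution R) act)/=.
  by apply: eq_bigr => f _; rewrite setTI -gain_region_probE.
by move=> f; rewrite setTI; exact: measurable_gain_region.
Qed.

Lemma infeasible_prob_ge0 P b : 0 <= infeasible_prob P b.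
Proof. exact: fine_ge0. Qed.

(** Infeasibility forces |h|^2 < P_k / P, so for large P the real part of the gain lies in a short
    interval around 0, which has small probability as the normal density is bounded. *)
Lemma cvg_infeasible_prob b : infeasible_prob P b @[P --> +oo] --> 0.
Proof.
pose s : R := Num.sqrt 2^-1.
have s0 : s != 0 by rewrite gt_eqF// sqrtr_gt0 invr_gt0.
apply/cvgrPdist_le => e e0.
have k0 : 0 < normal_peak s by exact: normal_peak_gt0.
(* Chosen so that the peak density times the length 2 del equals e. *)
pose del := e / (normal_peak s * 2).
have d0 : 0 < del by rewrite divr_gt0// mulr_gt0.
near=> P.
have P0 : 0 < P by near: P; apply: nbhs_pinfty_gt; exact: num_real.
have Pc : rx_level M rate b / del ^+ 2 <= P.
  by near: P; apply: nbhs_pinfty_ge; exact: num_real.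
rewrite sub0r normrN ger0_norm ?infeasible_prob_ge0//.
rewrite -lee_fin fineK; last first.
  by rewrite fin_num_measure//; exact: measurable_infeasible_gain.
apply: (@le_trans _ _ (gain_distribution R (`](- del)%R, del[ `*` setT))).
  apply: le_measure.
  - by apply: mem_set; exact: measurable_infeasible_gain.
  - by apply: mem_set; exact: measurableX.
  move=> g /=; rewrite -ltNge => h; split=> //=; rewrite in_itv/= -ltr_norml.
  have : P * (g.1 ^+ 2) < P * del ^+ 2.
    apply: (@le_lt_trans _ _ (P * (g.1 ^+ 2 + g.2 ^+ 2))).
      by rewrite ler_wpM2l ?(ltW P0)// lerDl sqr_ge0.
    by apply: lt_le_trans h _; rewrite -ler_pdivrMr// exprn_gt0.
  rewrite ltr_pM2l// -[g.1 ^+ 2]real_normK ?num_real//.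
  by rewrite ltr_pXn2r ?nnegrE// ltW.
rewrite /gain_distribution /= product_measure1E// /gain_component /= probability_setT mule1.
apply: le_trans (normal_prob_centered_itv_le _ _ s0 d0) _.
by rewrite lee_fin /del mulrA mulrC divfK// mulf_neq0// gt_eqF.
Unshelve. all: by end_near.
Qed.

End feasibility.

(** * The average age and its limit for unbounded power *)

Section average_age.
Context {R : realType} {m : nat} {ptx : R}.
Variables (X : noma_model m.+1 ptx) (rate T : R) (i : 'I_m.+1).
Hypotheses (T0 : 0 < T) (ptx01 : 0 < ptx <= 1).

Definition sends b : pred action := fun v => [&& v.1.1, v.1.2 == b & level_of b v.2].

Let ptx01' : 0 <= ptx <= 1.
Proof. by case/andP: ptx01 => /ltW -> ->. Qed.

Let law P (v : action) : R := @action_law R m.+1 ptx rate P v.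

Lemma sum_action_law P (Q S : pred (bool * bool)) : \sum_(v | Q v.1 && S v.2) law P v =
  (\sum_(f | S f) @gain_region_prob R m.+1 rate P f) *
  \sum_(u | Q u) bernoulli_pmf 2^-1 u.2 * bernoulli_pmf ptx u.1.
Proof.
rewrite mulrC mulr_suml -(pair_big Q S (fun u f => law P (u, f)))/=.
by apply: eq_bigr => u _; rewrite mulr_sumr; apply: eq_bigr => f _; rewrite mulrC.
Qed.

Lemma sum_law1 P : \sum_v law P v = 1.
Proof.
have -> : \sum_v law P v = \sum_(v : action | xpredT v.1 && xpredT v.2) law P v by [].
rewrite (sum_action_law P xpredT xpredT).
rewrite sum_gain_region_prob mul1r.
rewrite -(pair_bigA _ (fun a h => bernoulli_pmf 2^-1 h * bernoulli_pmf ptx a))/=.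
by rewrite !big_bool /= /bernoulli_pmf; field.
Qed.

Lemma sum_sends P b : \sum_(v | sends b v) law P v =
  (1 - @infeasible_prob R m.+1 rate P b) * (ptx / 2).
Proof.
rewrite (eq_bigl (fun v : action => (v.1.1 && (v.1.2 == b)) && level_of b v.2)); last first.
  by move=> v; rewrite /sends andbA.
rewrite (sum_action_law P (fun u => u.1 && (u.2 == b))); congr (_ * _).
  rewrite infeasible_probE -(sum_gain_region_prob (M := m.+1) rate P).
  by rewrite [X in _ = X - _](bigID (level_of b))/= addrK.
rewrite -(pair_big id (pred1 b) (fun a h => bernoulli_pmf 2^-1 h * bernoulli_pmf ptx a))/=.
rewrite big_mkcond big_bool /= addr0 big_pred1_eq /bernoulli_pmf.
by case: b; field.
Qed.

Lemma sendsN v : sends true v -> ~~ sends false v.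
Proof. by rewrite /sends => /and3P[_ /eqP -> _]; rewrite andbF. Qed.

Lemma transmits_actions P n (w : Om X) b j :
  transmits rate P n w b j = sends b (actions X rate P n w j).
Proof. by rewrite /transmits /sends ffunE /=; case: b. Qed.

Lemma succeedsE P n (w : Om X) :
  succeeds rate P i n w = decoded (sends true) (sends false) i (actions X rate P n w).
Proof.
rewrite /succeeds /decoded /num_tx !transmits_actions.
have e b : #|[pred j | transmits rate P n w b j]| =
    #|[pred j | sends b (actions X rate P n w j)]|.
  by apply: eq_card => j; rewrite !inE transmits_actions.
by rewrite !e.
Qed.

Definition slot_success_prob P : R := success_prob m
  ((1 - @infeasible_prob R m.+1 rate P true) * (ptx / 2))
  ((1 - @infeasible_prob R m.+1 rate P false) * (ptx / 2)).

Lemma slot_success_probE P : slot_success_prob P =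
  \sum_(c | decoded (sends true) (sends false) i c) \prod_j law P (c j).
Proof. by rewrite (sum_decoded _ _ _ i (sum_law1 P) sendsN) !sum_sends. Qed.

Lemma average_AoIE P : 0 < slot_success_prob P ->
  average_AoI X rate T P i = T * ((slot_success_prob P)^-1 + 2^-1).
Proof.
move=> q0.
have mX n c : measurable [set w | actions X rate P n w = c] by exact: measurable_actions.
have lX := prob_actions X rate P ptx01'.
have iid := iid_bits_good (Pr X) _ _ mX lX (decoded (sends true) (sends false) i).
have q1 := prob_good_le1 (Pr X) _ _ mX lX (decoded (sends true) (sends false) i).
rewrite -slot_success_probE in iid q1.
have q01 : 0 < slot_success_prob P <= 1 by rewrite q0.
have ae : {ae Pr X, forall w, time_average rate T P i w tau @[tau --> +oo] -->
    T * ((slot_success_prob P)^-1 + 2^-1)}.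
  have := ae_cvg_mean_age (Pr X) _ _ q01 iid.
  apply: filterS => w h.
  have := @cvg_average_age R T (fun n => succeeds rate P i n w) T0 (slot_success_prob P)^-1.
  apply; rewrite (_ : (fun n => succeeds rate P i n w) =
    (fun n => decoded (sends true) (sends false) i (actions X rate P n w)))//.
  by apply/funext => n; rewrite succeedsE.
(* Two almost sure limits coincide: both convergences hold at a common outcome, since an event of
   full probability is nonempty. *)
apply: get_unique => // D aeD.
have ap : ProperFilter (nbhs (almost_everywhere (Pr X))).
  have PT : (0 < Pr X setT)%E by rewrite probability_setT lte01.
  exact: ae_properfilter_algebraOfSetsType PT.
have [w [h1 h2]] := filter_ex (filterI ae aeD).
by apply: cvg_unique h2 h1.
Qed.

Lemma success_prob_cvg (F : set_system R) (a b : R -> R) (x y : R) : Filter F ->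
  a P @[P --> F] --> x -> b P @[P --> F] --> y ->
  success_prob m (a P) (b P) @[P --> F] --> success_prob m x y.
Proof.
move=> FF ax bly.
have pw (f : R -> R) (l : R) n : f P @[P --> F] --> l -> f P ^+ n @[P --> F] --> l ^+ n.
  move=> fl; apply: (@continuous_cvg _ _ _ _ _ _ (fun z : R => z ^+ n)) => //.
  exact: exprn_continuous.
have a1 : (1 - a P) @[P --> F] --> 1 - x by apply: cvgB => //; exact: cvg_cst.
have ab1 : (1 - a P - b P) @[P --> F] --> 1 - x - y by exact: cvgB.
apply: cvgD; first apply: cvgD.
- by apply: cvgM => //; exact: pw.
- by apply: cvgM => //; exact: pw.
- apply: cvgM; first exact: cvg_cst.
  by apply: cvgM; [exact: cvgM|exact: pw].
Qed.

Lemma limit_AoIE :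
  limit_AoI X rate T i = T * ((success_prob m (ptx / 2) (ptx / 2))^-1 + 2^-1).
Proof.
have c b : (1 - @infeasible_prob R m.+1 rate P b) * (ptx / 2) @[P --> +oo] --> ptx / 2.
  suff : (1 - @infeasible_prob R m.+1 rate P b) * (ptx / 2) @[P --> +oo] --> (1 - 0) * (ptx / 2).
    by rewrite subr0 mul1r.
  apply: cvgM; last exact: cvg_cst.
  by apply: cvgB; [exact: cvg_cst|exact: cvg_infeasible_prob].
have cq : slot_success_prob P @[P --> +oo] --> success_prob m (ptx / 2) (ptx / 2).
  exact: success_prob_cvg.
have q0 : 0 < success_prob m (ptx / 2) (ptx / 2).
  by case/andP: ptx01 => p0 p1; apply: success_prob_gt0; lra.
(* The formula for the average age requires a positive success probability; positivity of the limit
   gives it for all large P. *)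
have np : \forall P \near +oo, 0 < slot_success_prob P by apply: (cvgr_gt _ cq).
apply/cvg_lim => //.
have : T * ((slot_success_prob P)^-1 + 2^-1) @[P --> +oo] -->
    T * ((success_prob m (ptx / 2) (ptx / 2))^-1 + 2^-1).
  apply: cvgM; first exact: cvg_cst.
  apply: cvgD; last exact: cvg_cst.
  by apply: cvgV => //; rewrite gt_eqF.
apply: cvg_trans; apply: near_eq_cvg.
by apply: filterS np => P qP; rewrite average_AoIE.
Qed.

End average_age.

Theorem lemma2 (R : realType) (T rate : R) (hT : 0 < T) (hrate : 0 < rate)
    (X : forall (m : nat) (p : {p : R | 0 < p <= 1}),
           noma_model m.+1 (sval p)) :
  exists eta : R,
    [/\ 0 < eta,
        (1 - eta / 2) * expR (- (eta / 2))
          + (1 - eta ^+ 2 / 2) * expR (- eta) = 0,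
        (forall x : R, 0 < x ->
           (1 - x / 2) * expR (- (x / 2)) + (1 - x ^+ 2 / 2) * expR (- x) = 0 ->
           x = eta) &
        forall pstar : nat -> {p : R | 0 < p <= 1},
          (forall (m : nat) (p : {p : R | 0 < p <= 1}),
             limit_AoI (X m (pstar m)) rate T ord0
               <= limit_AoI (X m p) rate T ord0) ->
          m.+1%:R * sval (pstar m) @[m --> \oo] --> eta].
Proof.
have [eta [eta0 root dpos dneg]] := exists_root_dthroughput (R := R).
exists eta; split => //.
  move=> x x0 rx; have [xe|ex|//] := ltgtP x eta.
  - by have := dpos x; rewrite (ltW x0) xe => /(_ isT); rewrite /dthroughput rx ltxx.
  - by have := dneg x ex; rewrite /dthroughput rx ltxx.
move=> pstar hmin.
apply: (cvg_success_prob_maximizer eta eta0 (fun m => sval (pstar m))) => //.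
  by move=> m; exact: (svalP (pstar m)).
move=> m p' p'01; have := hmin m (exist _ p' p'01).
have ps01 := svalP (pstar m).
(* The age is increasing in the inverse of the success probability, so comparing ages reverses into
   comparing success probabilities. *)
rewrite !limit_AoIE// ler_pM2l// lerD2r lef_pV2 ?posrE//.
- have /andP[p0 p1] := ps01; apply: success_prob_gt0; lra.
- have /andP[p0 p1] := p'01; apply: success_prob_gt0; rewrite /=; lra.
Qed.
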